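(* Let $p$ and $q$ be primes and let $(P,\alpha)$ be a maximal $(p,q)$-pair of rank $3$. Then $P$ has nilpotency class at most $3$ and order at most $p^6$; moreover, if $|P|=p^6$, then $(p,q)=(3,2)$.
   Context: For a finite group $G$, $\mathrm{d}(G)$ denotes the minimum number of generators of $G$ and $\Phi(G)$ its Frattini subgroup. A power automorphism of a finite group is an automorphism sending every subgroup to itself. Let $p,q$ be primes. A maximal $(p,q)$-pair of rank $d$ is a pair $(P,\alpha)$ where $P$ is a finite $p$-group, $\alpha\in\mathrm{Aut}(P)$ has prime order $q$ dividing $p-1$, and: (a) the minimal number of generators of every subgroup of $P$ is at most $\mathrm{d}(P)=d$; (b) the image of $\alpha$ in $\mathrm{Aut}(P/\Phi(P))$ is a non-trivial power automorphism; (c) if $H$ is a proper subgroup of $P$ with $\mathrm{d}(H)=\mathrm{d}(P)$, then either $\alpha(H)\neq H$ or the image of $\alpha$ in $\mathrm{Aut}(H/\Phi(H))$ is not a non-trivial power automorphism. *)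

(* Defs.v *)
From mathcomp Require Import all_boot all_fingroup all_solvable.

Set Implicit Arguments.
Unset Strict Implicit.
Unset Printing Implicit Defensive.

Import GroupScope.

Definition power_aut (gT : finGroupType) (G : {group gT}) (a : {perm gT}) : Prop :=
  a \in Aut G /\
  forall K : {group gT}, K \subset G -> a @: K = K :> {set gT}.

Definition nontrivial_power_aut (gT : finGroupType) (G : {group gT})
    (a : {perm gT}) : Prop :=
  power_aut G a /\ a != 1.

(* The automorphism of H / 'Phi(H) induced by an automorphism a of an overgroup
   of H such that a @: H = H (if a @: H != H, restr_perm H a is the identity).
   The lemmas frattini_aut_Aut and frattini_autE below characterize it. *)
Definition frattini_aut (gT : finGroupType) (H : {group gT}) (a : {perm gT}) :
    {perm coset_of 'Phi(H)} :=
  actperm ([Aut H] / 'Phi(H)) (restr_perm H a).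

Lemma Aut_qact_dom_Phi (gT : finGroupType) (H : {group gT}) (b : {perm gT}) :
  b \in Aut H -> b \in qact_dom [Aut H] 'Phi(H).
Proof.
move=> AutHb; rewrite (qact_domE [Aut H] (Phi_sub H)).
rewrite inE AutHb inE; apply/subsetP=> x Phix.
have /charP[_ charPhi] := Phi_char H.
have Phib: [set b y | y in 'Phi(H)] = 'Phi(H).
  rewrite -{2}(charPhi _ (injm_autm AutHb) (im_autm AutHb)).
  by rewrite morphimEsub ?Phi_sub //=; apply: eq_imset => y; rewrite autmE.
by rewrite inE /= /autact /= /aperm -Phib imset_f.
Qed.

Lemma frattini_aut_Aut (gT : finGroupType) (G H : {group gT}) (a : {perm gT}) :
  a \in Aut G -> H \subset G -> frattini_aut H a \in Aut (H / 'Phi(H)).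
Proof.
move=> AutGa sHG; apply: (@actperm_Aut _ _ _ _ ([Aut H] / 'Phi(H))%gact).
exact/Aut_qact_dom_Phi/(Aut_restr_perm sHG).
Qed.

Lemma frattini_autE (gT : finGroupType) (G H : {group gT}) (a : {perm gT})
    (x : gT) :
    a \in Aut G -> H \subset G -> a @: H = H :> {set gT} -> x \in H ->
  frattini_aut H a (coset 'Phi(H) x) = coset 'Phi(H) (a x).
Proof.
move=> AutGa sHG aH Hx.
have Na: a \in 'N(H | 'P).
  by rewrite inE in_setT inE; apply/subsetP=> y Hy; rewrite inE /= /aperm -aH imset_f.
rewrite actpermE /= qactE /=; first by rewrite /autact /= /aperm restr_permE.
  exact: subsetP (gFnorm _ _) x Hx.
exact/Aut_qact_dom_Phi/(Aut_restr_perm sHG).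
Qed.

(* 'm(H) is the minimal number of generators of H; automorphisms of P are
   permutations of the ambient group type fixing the complement of P, so that
   #[a] is also the order of a in Aut P. *)
Record maximal_pair (p q d : nat) (gT : finGroupType) (P : {group gT})
    (a : {perm gT}) : Prop := MaximalPair {
  maxpair_pgroup : p.-group P;
  maxpair_aut : a \in Aut P;
  maxpair_order : #[a] = q;
  maxpair_dvd : q %| p - 1;
  maxpair_rank : 'm(P) = d;
  maxpair_sub_rank : forall H : {group gT}, H \subset P -> 'm(H) <= d;
  maxpair_power : nontrivial_power_aut (P / 'Phi(P)) (frattini_aut P a);
  maxpair_maximal : forall H : {group gT}, H \proper P -> 'm(H) = 'm(P) ->
    a @: H <> H :> {set gT} \/
    ~ nontrivial_power_aut (H / 'Phi(H)) (frattini_aut H a)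
}.

(* Main.v *)
Require Import Defs.
From mathcomp Require Import all_boot all_fingroup all_solvable.

(* Let a act on P / Phi(P) as the scalar l, and write L_i for the lower central
   series. Lifting Omega_1 of an abelian quotient shows Phi(P) = L_2, whence a
   acts on L_i / L_{i+1} as l^i and these factors have exponent p. The rank
   bound forces |L_2 : L_3| <= p (otherwise two independent elements of P / L_2
   commute modulo L_3) and then |L_3 : L_4| <= p^2. Let Z be the preimage of
   the center of P / L_3.
   If l^2 <> 1, then L_3 = 1: the centralizer of L_2 modulo a suitable N of
   index p in L_3 is elementary abelian of order p^4 modulo N, since the
   eigenvalues l, l^2, l^3 that could link its commutators and p-th powers to N
   are incompatible.
   If l = -1, then q = 2 and x (a x)^-1 is inverted by a and congruent to x^2
   modulo L_2, for all x. Hence Z \ L_2 contains an inverted z, which is then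
   central modulo L_4. An elementary abelian section of rank 3 generated by inverted
   elements contradicts maximality; applied to <k>L_3 / L_4 when
   |L_3 : L_4| = p^2, this gives k^p \notin L_4 for k \notin L_2. Put
   T = <z^p>L_4 and A = C_P(L_2 / T). If L_4 <> 1, then x^p \in T for
   x \notin A, which yields either such a k or the section <x, z>L_3 / L_4. If
   |L_3 : L_4| = p^2 and p > 3, then (xy)^p = x^p y^p modulo T for y \in A,
   which again produces such a k. *)

Set Implicit Arguments.
Unset Strict Implicit.
Unset Printing Implicit Defensive.

(** * Commutators, powers and indices in finite groups *)

Section GroupFacts.

Import GroupScope.

Variable gT : finGroupType.
Implicit Types (G H K M N : {group gT}) (x y c : gT).

(** By finiteness, closure of Q under products is enough and inverses need no clause. *)
Lemma gen_ind (S : {set gT}) (Q : pred gT) :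
    Q 1 -> {in S, forall x, Q x} ->
    {in <<S>> &, forall x y, Q x -> Q y -> Q (x * y)} ->
  {in <<S>>, forall x, Q x}.
Proof.
move=> Q1 QS QM.
have gE: group_set [set x in <<S>> | Q x].
  apply/group_setP; split=> [|x y]; first by rewrite inE group1.
  by rewrite !inE => /andP[Sx Qx] /andP[Sy Qy]; rewrite groupM //= QM.
suff: <<S>> \subset Group gE.
  by move/subsetP=> sSE x /sSE; rewrite inE => /andP[].
by rewrite gen_subG; apply/subsetP=> x Sx; rewrite inE mem_gen //= QS.
Qed.

Lemma coset1_mem N G x : N <| G -> x \in G -> (coset N x == 1) = (x \in N).
Proof.
move=> /andP[_ nNG] Gx; apply/eqP/idP=> [|Nx]; last exact: coset_id.
exact/coset_idr/(subsetP nNG).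
Qed.

Lemma cosetpre_normal_quo N G (U : {group coset_of N}) :
  N <| G -> (coset N @*^-1 U <| G) = (U <| G / N).
Proof. by move=> nN; rewrite -{1}(quotientGK nN) cosetpre_normal. Qed.

Lemma index_cosetpre_quo N G (U : {group coset_of N}) :
  N <| G -> #|G : coset N @*^-1 U| = #|G / N : U|.
Proof. by move=> nN; rewrite -{1}(quotientGK nN) index_cosetpre. Qed.

Lemma commg_mul_commute x y u v :
    commute u x -> commute u y -> commute u v -> commute v x -> commute v y ->
  [~ x * u, y * v] = [~ x, y].
Proof.
move=> ux uy uv vx vy.
have cR w : commute w x -> commute w y -> [~ x, y] ^ w = [~ x, y].
  by move=> wx wy; rewrite conjRg !conjgE -wx -wy !mulKg.
have /commgP/eqP uyv : commute u (y * v) by apply: commuteM.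
have /commgP/eqP xv := commute_sym vx.
by rewrite commMgJ uyv mulg1 commgMJ xv mul1g !cR.
Qed.

(** Collection formula: moving x to the left past y^i creates c^i, and past c^i creates d^i.
    Pascal's rule then turns the accumulated exponents into binomial coefficients. *)
Lemma expMg_metabelian x y n :
    let c := [~ y, x] in let d := [~ c, x] in
    commute y c -> commute d x -> commute d y -> commute d c ->
  (x * y) ^+ n = x ^+ n * y ^+ n * c ^+ 'C(n, 2) * d ^+ 'C(n, 3).
Proof.
move=> c d yc dx dy dc.
have yx i : y ^+ i * x = x * (y ^+ i * c ^+ i).
  by rewrite conjgC conjXg conjg_mulR expgMn.
have cx i : c ^+ i * x = x * (c ^+ i * d ^+ i).
  by rewrite conjgC conjXg conjg_mulR expgMn //; apply: commute_sym.
have X i (z w : gT) : commute z w -> z ^+ i * w = w * z ^+ i.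
  by move=> zw; exact (commute_sym (commuteX i (commute_sym zw))).
elim: n => [|n IHn]; first by rewrite !mulg1.
rewrite !binS bin1 [X in c ^+ X]addnC [X in d ^+ X]addnC !expgD expgSr IHn.
rewrite (expgSr x) (expgSr y) -!mulgA; congr (_ * _).
rewrite (mulgA (d ^+ _) x) (X _ _ _ dx) -(mulgA x) (mulgA (c ^+ _) x) cx.
rewrite -!mulgA (mulgA (y ^+ _) x) yx -!mulgA; congr (_ * (_ * _)).
rewrite (X _ _ _ dy) (mulgA (d ^+ _) y) (X _ _ _ dy) -(mulgA y).
rewrite (mulgA (c ^+ 'C(n, 2)) y) (X _ _ _ (commute_sym yc)) -(mulgA y).
by rewrite (mulgA (c ^+ n) y) (X _ _ _ (commute_sym yc)) -(mulgA y).
Qed.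

Lemma expg_coprime_eq1 (p : nat) n x :
  prime p -> ~~ (p %| n) -> x ^+ p = 1 -> x ^+ n = 1 -> x = 1.
Proof.
move=> p_pr pn /eqP xp /eqP xn; apply/eqP; rewrite -order_eq1 -dvdn1.
have /eqP <-: coprime p n by rewrite prime_coprime.
by rewrite dvdn_gcd !order_dvdn xp.
Qed.

Lemma expg_congr (p : nat) m n x : m = n %[mod p] -> x ^+ p = 1 ->
  x ^+ m = x ^+ n.
Proof. by move=> mn xp; rewrite -(expg_mod m xp) mn expg_mod. Qed.

(* The commutators [c, g] already form a group, in bijection with the class of
   c, so they exhaust [K, G]. *)
Lemma card_commg_cyclic_center G K M c :
    M \subset 'Z(G) -> c \in K -> K \subset G ->
    K \subset M * <[c]> -> [~: K, G] \subset M ->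
  #|[~: K, G]| = #|G : 'C_G(K)|.
Proof.
move=> sMZ Kc sKG sKMc sKGM; have [sMG cGM] := subsetIP sMZ.
have Gc := subsetP sKG c Kc.
have cM u g : u \in M -> g \in G -> commute u g.
  by move=> Mu Gg; apply: (centP (subsetP cGM u Mu)).
have Mcg g : g \in G -> [~ c, g] \in M.
  by move=> Gg; apply: (subsetP sKGM); apply: mem_commg.
have CE : 'C_G(K) = 'C_G[c].
  apply/eqP; rewrite eqEsubset -cent_set1 setIS ?centS ?sub1set //= cent_set1.
  apply/subsetP=> g /setIP[Gg cg]; rewrite inE Gg; apply/centP=> k Kk.
  have /mulsgP[m d Mm cd ->] := subsetP sKMc k Kk.
  apply: commuteM; first by apply: commute_sym; apply: cM.
  by have /cycleP[i ->] := cd; apply/commuteX/cent1P.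
pose S := [set [~ c, g] | g in G].
have gS : group_set S.
  apply/group_setP; split; first by apply/imsetP; exists 1; rewrite ?commg1.
  move=> _ _ /imsetP[g Gg ->] /imsetP[h Gh ->].
  apply/imsetP; exists (h * g); first exact: groupM.
  rewrite commgMJ; congr (_ * _).
  by rewrite conjgE (cM _ _ (Mcg h Gh) Gg) mulKg.
have SE : [~: K, G] = S.
  apply/eqP; rewrite eqEsubset; apply/andP; split; last first.
    by apply/subsetP=> _ /imsetP[g Gg ->]; apply: mem_commg.
  rewrite -[S]/(gval (Group gS)) gen_subG.
  apply/subsetP=> _ /imset2P[k g Kk Gg ->].
  have /mulsgP[m d Mm /cycleP[i ->] ->] := subsetP sKMc k Kk.
  rewrite commMgJ.
  have ->: [~ m, g] = 1 by apply/eqP/commgP; apply: cM.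
  rewrite conj1g mul1g commXg; last by apply/commute_sym/cM => //; apply: Mcg.
  by apply: groupX; apply/imsetP; exists g.
rewrite SE CE index_cent1 -(card_lcoset S c); congr #|pred_of_set _|.
apply/setP=> y; apply/lcosetP/imsetP=> [[_ /imsetP[g Gg ->] ->] | [g Gg ->]].
  by exists g; rewrite // conjg_mulR.
by exists [~ c, g]; rewrite ?conjg_mulR // imset_f.
Qed.

Lemma modn_cancel (p : nat) k m n :
  prime p -> ~~ (p %| k) -> k * m = k * n %[mod p] -> m = n %[mod p].
Proof.
move=> p_pr pk; wlog le_mn : m n / n <= m => [IH|].
  by case/orP: (leq_total n m) => le_mn E; [|symmetry]; apply: IH => //.
move/eqP; rewrite eqn_mod_dvd ?leq_mul2l ?le_mn ?orbT // -mulnBr.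
by rewrite Euclid_dvdM // (negPf pk) /= -eqn_mod_dvd // => /eqP.
Qed.

(** Used to compare eigenvalues: an element of exponent p on which a acts both as the power m and as
    the power n must vanish. *)
Lemma expg_ncongr_eq1 (p : nat) m n x :
  prime p -> m <> n %[mod p] -> x ^+ p = 1 -> x ^+ m = x ^+ n -> x = 1.
Proof.
move=> p_pr; wlog le_mn : m n / n <= m => [IH|].
  case/orP: (leq_total n m) => le_mn nmn xp xmn; first exact: (IH m n).
  by apply: (IH n m) => // /esym.
move=> /eqP; rewrite eqn_mod_dvd // => nmn xp xmn.
apply: (expg_coprime_eq1 p_pr nmn xp); apply: (mulgI (x ^+ n)).
by rewrite -expgD subnKC // mulg1.
Qed.

Lemma three_subgroup_mod G H K N :
    G \subset 'N(N) -> H \subset 'N(N) -> K \subset 'N(N) ->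
    [~: G, H, K] \subset N -> [~: H, K, G] \subset N ->
  [~: K, G, H] \subset N.
Proof.
move=> nG nH nK.
have RE (A B C : {group gT}) :
    A \subset 'N(N) -> B \subset 'N(N) -> C \subset 'N(N) ->
  ([~: A, B, C] \subset N) = ([~: A / N, B / N, C / N] == 1).
  move=> nA nB nC; have nAB : [~: A, B] \subset 'N(N) by apply: comm_subG.
  rewrite -(quotientR nA nB) -(quotientR nAB nC) -subG1 quotient_sub1 //.
  exact: comm_subG.
rewrite !RE // => /eqP GHK /eqP HKG; apply/eqP; exact: three_subgroup.
Qed.

Lemma prime_index_sub_mul N M c :
  N <| M -> prime #|M : N| -> c \in M -> c \notin N -> M \subset N * <[c]>.
Proof.
move=> /andP[sNM nNM] pr_MN Mc Nc.
have scM : <[c]> \subset M by rewrite cycle_subG.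
rewrite -norm_joinEr ?(subset_trans scM) //.
have sJM : N <*> <[c]> \subset M by rewrite join_subG sNM.
have := Lagrange_index sJM (joing_subl N <[c]>) => E.
have /primeP[_ /(_ #|M : N <*> <[c]>|)] := pr_MN.
rewrite -E dvdn_mulr // => /(_ isT)/orP[|]; first by rewrite indexg_eq1.
rewrite -{1}[#|M : _|]muln1 eqn_pmul2l ?indexg_gt0 // => /eqP/esym/eqP.
rewrite indexg_eq1 join_subG cycle_subG => /andP[_]; by rewrite (negPf Nc).
Qed.

(** If equality held, G would be extraspecial, and the order of an extraspecial p-group is an odd
    power of p. *)
Lemma center_neq_der1 (p : nat) G :
    prime p -> p.-group G -> #|G| = (p ^ 4)%N -> 'Phi(G) = G^`(1) ->
    #|G^`(1)| = p ->
  'Z(G) != G^`(1).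
Proof.
move=> p_pr pG oG PhiG oG'; apply/eqP => ZG.
have [|n _ /eqP] := card_extraspecial pG.
  by split; [split; rewrite ZG | rewrite ZG oG'].
rewrite oG eqn_exp2l ?prime_gt1 // => /eqP/(congr1 odd).
by rewrite /= odd_double.
Qed.

End GroupFacts.

(* rankP and maxP are the rank and maximality conditions of a (p, q)-pair,
   transported to elementary abelian sections. *)
Section Core.

Import GroupScope.

Variables (gT : finGroupType) (P : {group gT}) (a : {perm gT}) (p l q : nat).

Hypothesis p_pr : prime p.
Hypothesis pP : p.-group P.
Hypothesis AutPa : a \in Aut P.
Hypothesis aPhi :
  {in P, forall x, coset 'Phi(P) (a x) = coset 'Phi(P) x ^+ l}.
Hypothesis a_iter : forall x, iter q a x = x.
Hypothesis lq : l ^ q = 1 %[mod p].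
Hypothesis pNq : ~~ (p %| q).
Hypothesis l1 : l <> 1 %[mod p].
Hypothesis indexPhi : #|P : 'Phi(P)| = (p ^ 3)%N.
Hypothesis rankP : forall (N : {group gT}) (E : {group coset_of N}),
  N <| P -> E \subset P / N -> p.-abelem E -> #|E| <= p ^ 3.
Hypothesis maxP : forall (N : {group gT}) (E : {group coset_of N}) (m : nat),
  N <| P -> {in N, forall x, a x \in N} -> E \proper P / N -> p.-abelem E ->
  #|E| = (p ^ 3)%N -> m <> 1 %[mod p] ->
  {in P, forall x, coset N x \in E -> coset N (a x) = coset N x ^+ m} -> False.

Implicit Types (N M K H : {group gT}) (x y z : gT).

(** * Elementary rules for a and for cosets of normal subgroups *)

Lemma a_in x : x \in P -> a x \in P.
Proof. by move=> Px; rewrite Aut_closed. Qed.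

Lemma aM : {in P &, {morph a : x y / x * y}}.
Proof. by move=> x y Px Py; rewrite -!(autmE AutPa) morphM. Qed.

Lemma aX n x : x \in P -> a (x ^+ n) = a x ^+ n.
Proof. by move=> Px; rewrite -!(autmE AutPa) morphX. Qed.

Lemma aV x : x \in P -> a x^-1 = (a x)^-1.
Proof. by move=> Px; rewrite -!(autmE AutPa) morphV. Qed.

Lemma aR x y : x \in P -> y \in P -> a [~ x, y] = [~ a x, a y].
Proof. by move=> Px Py; rewrite -!(autmE AutPa) morphR. Qed.

Lemma a_char N : N \char P -> {in N, forall x, a x \in N}.
Proof.
move=> /charP[sNP chN] x Nx.
have <- : autm AutPa @* N = N by rewrite chN ?injm_autm ?im_autm.
by rewrite -(autmE AutPa); apply: mem_morphim => //; apply: (subsetP sNP).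
Qed.

Lemma cosetM N : N <| P -> {in P &, {morph coset N : x y / x * y}}.
Proof.
by case/andP=> _ nNP x y Px Py; rewrite morphM ?(subsetP nNP).
Qed.

Lemma cosetX N n x : N <| P -> x \in P -> coset N (x ^+ n) = coset N x ^+ n.
Proof. by case/andP=> _ nNP Px; rewrite morphX ?(subsetP nNP). Qed.

Lemma cosetV N x : N <| P -> x \in P -> coset N x^-1 = (coset N x)^-1.
Proof. by case/andP=> _ nNP Px; rewrite morphV ?(subsetP nNP). Qed.

Lemma cosetR N x y :
  N <| P -> x \in P -> y \in P -> coset N [~ x, y] = [~ coset N x, coset N y].
Proof. by case/andP=> _ nNP Px Py; rewrite morphR ?(subsetP nNP). Qed.

Lemma coset_eqP N x y : N <| P -> x \in P -> y \in P ->
  coset N x = coset N y -> exists2 n, n \in N & x = y * n.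
Proof.
move=> nN Px Py xy; exists (y^-1 * x); last by rewrite mulKVg.
rewrite -(coset1_mem nN) ?groupM ?groupV //.
by rewrite cosetM ?groupV // cosetV // xy mulVg.
Qed.

Lemma a_congr N x y : N <| P -> {in N, forall x, a x \in N} ->
  x \in P -> y \in P -> coset N x = coset N y -> coset N (a x) = coset N (a y).
Proof.
move=> nN aN Px Py /coset_eqP[] // n Nn ->.
have Pn: n \in P by apply: (subsetP (normal_sub nN)).
by rewrite aM // cosetM ?a_in // (coset_id (aN n Nn)) mulg1.
Qed.

(** * The Frattini subgroup is the derived subgroup *)

Lemma p_l : ~~ (p %| l).
Proof.
apply/negP=> pl; case: (posnP q) => [q0 | q_gt0].
  by have := pNq; rewrite q0 dvdn0.
have : p %| l ^ q by rewrite Euclid_dvdX // pl.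
rewrite /dvdn lq modn_small ?prime_gt1 //.
Qed.

(** Otherwise, for the N chosen below, Omega_1 of P / N is a proper elementary abelian section of
    order p^3 on which a acts as the power l, against [maxP]. *)
Lemma Phi_der1 : 'Phi(P) = P^`(1).
Proof.
have sP'Phi : P^`(1) \subset 'Phi(P) by rewrite (Phi_joing pP) joing_subl.
apply/eqP; rewrite eqEsubset sP'Phi andbT; apply/idPn=> nsPhi.
(* P' makes P / N abelian, and Phi(Phi(P)) makes Phi(P) / N elementary abelian. Still Phi(P) is not
   inside N, since Phi(Phi(P)) consists of non-generators of Phi(P). *)
pose N := ('Phi('Phi(P)) <*> P^`(1))%G.
have chN : N \char P.
  by rewrite charY ?der_char // (char_trans (Phi_char _)) ?Phi_char.
have nN := char_normal chN; have nNP := normal_norm nN.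
have sNPhi : N \subset 'Phi(P) by rewrite join_subG Phi_sub.
have nsPhiN : ~~ ('Phi(P) \subset N).
  apply: contra nsPhi => sPhiN.
  have /(@Phi_nongen _ 'Phi(P)%G) <- : 'Phi('Phi(P)) <*> P^`(1) = 'Phi(P).
    by apply/eqP; rewrite eqEsubset sNPhi.
  by rewrite gen_subG.
have sPhiP := Phi_sub P.
have nNPhi := subset_trans sPhiP nNP.
have abQ : abelian (P / N) by rewrite sub_der1_abelian ?joing_subr.
have pQ : p.-group (P / N) by apply: quotient_pgroup.
have PhiQ : 'Phi(P) / N = 'Mho^1(P / N).
  by rewrite (quotient_Phi pP) // (Phi_Mho pQ).
pose E := 'Ohm_1(P / N)%G.
(* In an abelian group the orders of Omega_1 and Mho^1 multiply to the order of the group. Here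
   Mho^1 is Phi(P) / N, so |E| = |P : Phi(P)|. *)
have abE : p.-abelem E by apply: Ohm1_abelem.
have oE : #|E| = (p ^ 3)%N.
  have := mul_card_Ohm_Mho_abelian 1 abQ; rewrite -PhiQ !card_quotient //.
  rewrite -(Lagrange_index sPhiP sNPhi) indexPhi => /eqP.
  by rewrite eqn_pmul2r ?indexg_gt0 // => /eqP.
have prE : E \proper P / N.
  rewrite properEneq Ohm_sub andbT; apply: contra nsPhiN => /eqP EQ.
  have : p.-abelem (P / N) by rewrite -EQ.
  rewrite -(trivg_Phi pQ) -(quotient_Phi pP) // => /eqP Q1.
  by rewrite -quotient_sub1 // Q1.
have Phi_p t : t \in 'Phi(P) -> coset N t ^+ p = 1.
  move=> Pt; have Pt' := subsetP sPhiP t Pt.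
  rewrite -cosetX //; apply: coset_id; apply: (subsetP (joing_subl _ _)).
  have nPP : 'Phi('Phi(P)) <| 'Phi(P) by apply: Phi_normal.
  rewrite -(coset1_mem nPP) ?groupX // morphX ?(subsetP (normal_norm nPP)) //.
  have /abelemP[//|_ ->//] := Phi_quotient_abelem (pgroupS sPhiP pP).
  exact: mem_quotient.
have exN x : x \in P -> exists2 n, n \in 'Phi(P) & a x = x ^+ l * n.
  move=> Px; apply: (coset_eqP (Phi_normal P)); rewrite ?a_in ?groupX //.
  by rewrite aPhi // cosetX ?Phi_normal.
have cPN x y : x \in P -> y \in P -> commute (coset N x) (coset N y).
  by move=> Px Py; apply: (centsP abQ); apply: mem_quotient.
have aN := a_char chN.
(* Each element of Phi(P) / N is the coset of some y^p, and the error t in a y = y^l t satisfies t^p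
   \in N. *)
have actPhi n : n \in 'Phi(P) -> coset N (a n) = coset N n ^+ l.
  move=> Phin; have Pn := subsetP sPhiP n Phin.
  have : coset N n \in 'Phi(P) / N by apply: mem_quotient.
  rewrite PhiQ (MhoEabelian 1 pQ abQ) => /imsetP[_ /morphimP[y _ Py ->] /= yp].
  rewrite expn1 -cosetX // in yp.
  rewrite yp (a_congr nN aN _ _ yp) ?groupX // aX // !cosetX ?a_in //.
  have [t Pt ->] := exN y Py; have Pt' := subsetP sPhiP t Pt.
  rewrite cosetM ?groupX // expgMn; last by apply: cPN; rewrite ?groupX.
  by rewrite (Phi_p t) // mulg1 cosetX // expgAC.
apply: (maxP nN aN prE abE oE l1) => x Px Ex.
have xp : coset N x ^+ p = 1 by have /abelemP[//|_ ->] := abE.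
have [n Phin ax] := exN x Px; have Pn := subsetP sPhiP n Phin.
suff n1 : coset N n = 1 by rewrite ax cosetM ?groupX // n1 mulg1 cosetX.
(* Iterating a x = x^l n gives n the exponent k = i l^(i-1); the form k l = i l^i avoids a
   predecessor at i = 0. At i = q, where a^q = 1 and l^q = 1 modulo p, this leaves n^k = 1 modulo N
   with k prime to p. *)
have iterE i : exists2 k, (k * l = i * l ^ i)%N & iter i a x \in P /\
    coset N (iter i a x) = coset N x ^+ (l ^ i) * coset N n ^+ k.
  elim: i => [|i [k kE [Pi IHi]]] /=.
    by exists 0; rewrite // expg0 mulg1 expg1.
  exists (l ^ i + l * k)%N; 
    first by rewrite mulnDl -mulnA kE expnS mulSn (mulnC (l ^ i)%N) mulnCA.
  split; first exact: a_in.
  have -> : coset N (a (iter i a x)) = coset N (a (x ^+ (l ^ i) * n ^+ k)).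
    by apply: a_congr; rewrite ?groupM ?groupX ?cosetM ?cosetX ?groupX.
  rewrite aM ?groupX // !aX // cosetM ?groupX ?a_in // !cosetX ?a_in //.
  rewrite (actPhi n) // ax cosetM ?groupX // cosetX // expgMn; last first.
    by apply/commute_sym/commuteX; apply: cPN.
  by rewrite -!expgM expgD -!mulgA expnS.
have [k kE [_]] := iterE q; rewrite a_iter => /esym/eqP.
rewrite (expg_congr lq xp) expg1 -[X in _ == X]mulg1.
rewrite (can_eq (mulKg _)) => /eqP nk.
apply: (expg_coprime_eq1 p_pr _ (Phi_p n Phin) nk).
have : ~~ (p %| k * l).
  by rewrite kE Euclid_dvdM // Euclid_dvdX // !negb_or pNq (negbTE p_l).
by rewrite Euclid_dvdM // negb_or => /andP[].
Qed.

(** * Exponents of the lower central factors and the action of a on them *)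

Lemma normal_L n : 'L_n(P) <| P. Proof. exact: lcn_normal. Qed.

Lemma L_in n x : x \in 'L_n(P) -> x \in P.
Proof. exact: (subsetP (lcn_sub n P)). Qed.

Lemma L_S n x : x \in 'L_n.+1(P) -> x \in 'L_n(P).
Proof. exact: (subsetP (lcn_subS n P)). Qed.

Lemma L2_Phi : 'L_2(P) = 'Phi(P). Proof. by rewrite lcn2 Phi_der1. Qed.

Lemma a_L n : {in 'L_n(P), forall x, a x \in 'L_n(P)}.
Proof. exact: a_char (lcn_char n P). Qed.

Lemma comm_L n u x :
  u \in 'L_n(P) -> x \in P -> [~ u, x] \in 'L_n.+1(P).
Proof. by move=> Lu Px; apply: (subsetP (lcnSnS n P)); apply: mem_commg. Qed.

Lemma commute_mod N u x :
    N <| P -> u \in P -> x \in P ->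
  commute (coset N u) (coset N x) <-> [~ u, x] \in N.
Proof.
move=> nN Pu Px; rewrite -(coset1_mem nN) ?groupR // cosetR //.
by split=> [/commgP | /commgP].
Qed.

Lemma central_L n N u x : N <| P -> 'L_n.+1(P) \subset N ->
  u \in 'L_n(P) -> x \in P -> commute (coset N u) (coset N x).
Proof.
move=> nN sLN Lu Px; apply/commute_mod; rewrite // ?(L_in Lu) //.
exact/(subsetP sLN)/comm_L.
Qed.

(** Three subgroups lemma for P, P and L_{n+1}, since L_2 = [P, P]. *)
Lemma comm_L_L2 n : [~: 'L_n.+1(P), 'L_2(P)] \subset 'L_n.+3(P).
Proof.
rewrite commGC lcn2; apply: three_subgroup_mod; rewrite ?lcn_norm //=.
- exact: subset_trans (lcn_sub _ _) (lcn_norm _ _).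
- by rewrite (commGC P) -!lcnSn.
Qed.

Lemma coset_comm_L2 n u v N : N <| P -> 'L_n.+3(P) \subset N ->
  u \in 'L_n.+1(P) -> v \in 'L_2(P) -> commute (coset N u) (coset N v).
Proof.
move=> nN sLN Lu Lv; apply/commute_mod; rewrite ?(L_in Lu) ?(L_in Lv) //.
apply: (subsetP sLN); apply: (subsetP (comm_L_L2 n)); exact: mem_commg.
Qed.

Lemma commXX_L n u x i j N : N <| P -> 'L_n.+3(P) \subset N ->
    u \in 'L_n.+1(P) -> x \in P ->
  [~ coset N u ^+ i, coset N x ^+ j] = coset N [~ u, x] ^+ (i * j).
Proof.
move=> nN sLN Lu Px; have Pu := L_in Lu.
have c y : y \in P -> commute (coset N y) (coset N [~ u, x]).
  by move=> Py; apply/commute_sym/(central_L nN sLN) => //; apply: comm_L.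
rewrite commXg; last first.
  rewrite commgX -?cosetR //; last exact: c.
  by apply: commuteX; apply: c.
by rewrite commgX -?cosetR -?expgM 1?mulnC //; apply: c.
Qed.

Lemma L_ind n (Q : pred gT) :
    Q 1 -> {in 'L_n.+1(P) & P, forall u x, Q [~ u, x]} ->
    {in 'L_n.+2(P) &, forall x y, Q x -> Q y -> Q (x * y)} ->
  {in 'L_n.+2(P), forall x, Q x}.
Proof.
move=> Q1 QR QM; apply: gen_ind => // _ /imset2P[u x Lu Px ->].
exact: QR.
Qed.

(** The base case is Phi(P) = L_2. In the inductive step [u, x]^p = [u^p, x] modulo L_{n+3}, and u^p
    already lies one term lower than u. *)
Lemma L_expp n x : x \in 'L_n.+1(P) -> x ^+ p \in 'L_n.+2(P).
Proof.
elim: n x => [|n IHn] x.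
  rewrite lcn1 L2_Phi => Px.
  rewrite -(coset1_mem (Phi_normal P)) ?groupX // cosetX ?Phi_normal //.
  have /abelemP[//|_ ->//] := Phi_quotient_abelem pP.
  exact: mem_quotient.
move=> Lx; rewrite -(coset1_mem (normal_L _)) ?groupX ?(L_in Lx) //.
rewrite cosetX ?normal_L ?(L_in Lx) //; move: x Lx.
apply: (L_ind (Q := fun x => coset 'L_n.+3(P) x ^+ p == 1)).
- by rewrite coset_id ?expg1n.
- move=> u x Lu Px; have Pu := L_in Lu.
  rewrite -[p]muln1 -(commXX_L p 1 (normal_L n.+3) (subxx _) Lu Px).
  rewrite expg1 -cosetX // ?normal_L //.
  by apply/commgP/(central_L (normal_L n.+3) (subxx _)); rewrite ?IHn.
- move=> x y Lx Ly /eqP xp /eqP yp; have [Px Py] := (L_in Lx, L_in Ly).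
  rewrite cosetM ?normal_L // expgMn ?xp ?yp ?mulg1 //.
  exact: (central_L (normal_L n.+3) (subxx _)).
Qed.

Lemma coset_expp n N x : N <| P -> 'L_n.+2(P) \subset N ->
  x \in 'L_n.+1(P) -> coset N x ^+ p = 1.
Proof.
move=> nN sLN Lx; rewrite -cosetX ?(L_in Lx) //; apply: coset_id.
exact/(subsetP sLN)/L_expp.
Qed.

Lemma a_expand x : x \in P -> exists2 u, u \in 'L_2(P) & a x = x ^+ l * u.
Proof.
move=> Px; rewrite L2_Phi; apply: (coset_eqP (Phi_normal P)); rewrite ?a_in ?groupX //.
by rewrite aPhi // cosetX ?Phi_normal.
Qed.

(** By induction a [u, x] = [u^(l^(n+1)) v, x^l w] with v in L_{n+2} and w in L_2. Both corrections
    disappear modulo L_{n+3}, where the commutator is bilinear, so the eigenvalues multiply. *)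
Lemma a_coset_L n N x : N <| P -> 'L_n.+2(P) \subset N ->
  x \in 'L_n.+1(P) -> coset N (a x) = coset N x ^+ (l ^ n.+1).
Proof.
move=> nN sLN Lx.
suff {N nN sLN} E: coset 'L_n.+2(P) (a x) = coset 'L_n.+2(P) x ^+ (l ^ n.+1).
  have Px := L_in Lx; rewrite -cosetX ?normal_L // in E.
  have [] := coset_eqP (normal_L n.+2) _ _ E; rewrite ?a_in ?groupX // => u Lu ->.
  rewrite cosetM ?groupX ?(L_in Lu) // cosetX //.
  by rewrite (coset_id (subsetP sLN u Lu)) mulg1.
elim: n x Lx => [|n IHn]; first by move=> x; rewrite lcn1 L2_Phi expn1; apply: aPhi.
move=> x Lx; apply/eqP; move: x Lx.
apply: (L_ind (Q := fun x =>
  coset 'L_n.+3(P) (a x) == coset 'L_n.+3(P) x ^+ (l ^ n.+2))).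
- by rewrite coset_id ?a_L // coset_id // expg1n.
- move=> u x Lu Px; have Pu := L_in Lu.
  have := IHn u Lu; rewrite -cosetX ?normal_L // => /(coset_eqP (normal_L _)) [] //.
    + exact: a_in.
    + exact: groupX.
  move=> v Lv au; have [w Lw ax] := a_expand Px.
  have [Pv Pw] := (L_in Lv, L_in Lw).
  rewrite aR // cosetR ?a_in ?normal_L // au ax.
  have Pul : u ^+ (l ^ n.+1) \in 'L_n.+1(P) by apply: groupX.
  have Pxl : x ^+ l \in P by apply: groupX.
  rewrite (cosetM (normal_L n.+3) (L_in Pul) Pv) (cosetM (normal_L n.+3) Pxl Pw) commMgJ.
  rewrite [X in _ * X](_ : _ = 1) ?mulg1; last first.
    apply/eqP/commgP; rewrite -(cosetM (normal_L n.+3)) //.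
    by apply: (central_L (normal_L n.+3) (subxx _) Lv); apply: groupM.
  rewrite commgMJ [X in (X * _) ^ _](_ : _ = 1) ?mul1g; last first.
    exact/eqP/commgP/(coset_comm_L2 (normal_L n.+3) (subxx _) Pul Lw).
  rewrite (cosetX _ (normal_L n.+3) Pu) (cosetX _ (normal_L n.+3) Px).
  rewrite (commXX_L _ _ (normal_L n.+3) (subxx _) Lu Px) -expnSr -conjgM conjXg.
  rewrite -(cosetM (normal_L n.+3)) // conjgE.
  rewrite (central_L (normal_L n.+3) (subxx _) (comm_L Lu Px) (groupM Pw Pv)).
  by rewrite mulKg.
- move=> x y Lx Ly /eqP ax /eqP ay; have [Px Py] := (L_in Lx, L_in Ly).
  rewrite aM // !cosetM ?a_in ?normal_L // ax ay expgMn //.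
  exact: (central_L (normal_L n.+3) (subxx _)).
Qed.

(** On x^p, which lies in L_2, a acts modulo L_3 as l^2; expanding (x^l u)^p shows that it also acts
    as l. These differ modulo p because l <> 1. *)
Lemma expp_L3 x : x \in P -> x ^+ p \in 'L_3(P).
Proof.
move=> Px; have [u Lu ax] := a_expand Px; have Pu := L_in Lu.
have Lxp : x ^+ p \in 'L_2(P) by apply: L_expp.
rewrite -(coset1_mem (normal_L 3)) ?groupX //; apply/eqP.
apply: (expg_ncongr_eq1 p_pr (m := l * l) (n := l)).
- by rewrite -{3}[l]muln1 => /(modn_cancel p_pr p_l).
- exact: coset_expp (normal_L 3) _ Lxp.
- rewrite mulnn -(a_coset_L (normal_L 3)) // aX // ax !cosetX ?normal_L ?groupM ?groupX //.
  rewrite cosetM ?groupX ?normal_L // expgMn; last first.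
    by apply/commute_sym/(central_L (normal_L 3) (subxx _) Lu); apply: groupX.
  by rewrite (coset_expp (normal_L 3) _ Lu) // mulg1 cosetX ?normal_L // expgAC.
Qed.

Lemma abelem_quo_L3 (E : {group coset_of 'L_3(P)}) :
  E \subset P / 'L_3(P) -> abelian E -> p.-abelem E.
Proof.
move=> sEQ abE; apply/abelemP=> //; split=> // _ /(subsetP sEQ)/morphimP[x _ Px ->].
by rewrite /= -cosetX ?normal_L //; apply/coset_id/expp_L3.
Qed.

(** * The order of L_2 / L_3 *)

Lemma card_quo_L n : #|'L_2(P) / 'L_n.+2(P)| = #|'L_2(P) : 'L_n.+2(P)|.
Proof.
by rewrite card_quotient // (subset_trans (lcn_sub _ _)) ?lcn_norm.
Qed.

Lemma index_P_L n : #|P : 'L_n.+2(P)| = (p ^ 3 * #|'L_2(P) : 'L_n.+2(P)|)%N.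
Proof.
rewrite -indexPhi -L2_Phi; apply/esym/Lagrange_index; first exact: lcn_sub.
exact: lcn_sub_leq.
Qed.

Lemma center_quo_L3 : 'L_2(P) / 'L_3(P) \subset 'Z(P / 'L_3(P)).
Proof. exact: lcn_central. Qed.

Lemma index_L2_L3_le : #|'L_2(P) : 'L_3(P)| <= p.
Proof.
rewrite leqNgt; apply/negP=> W_gt; have p_gt1 := prime_gt1 p_pr.
pose Q := (P / 'L_3(P))%G; pose W := ('L_2(P) / 'L_3(P))%G.
have pQ : p.-group Q by apply: quotient_pgroup.
have sWQ : W \subset Q by apply: quotientS; apply: lcn_sub.
have sWZ : W \subset 'Z(Q) by apply: center_quo_L3.
have cWQ : Q \subset 'C(W) by rewrite centsC; have [_] := subsetIP sWZ.
have nWQ : W <| Q by rewrite /normal sWQ cents_norm.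
have oW : #|W| = (p ^ logn p #|W|)%N := card_pgroup (pgroupS sWQ pQ).
have oQ : #|Q| = (p ^ 3 * #|W|)%N.
  by rewrite card_quo_L -index_P_L card_quotient ?lcn_norm.
have Q'W : Q^`(1) = W by rewrite /= -quotient_der ?lcn_norm.
have PhiQ : 'Phi(Q) = W by rewrite -(quotient_Phi pP) ?lcn_norm // -L2_Phi.
set k := logn p #|W| in oW.
have k_gt1 : 1 < k.
  by rewrite -(ltn_exp2l _ _ p_gt1) expn1 -oW card_quo_L.
(* With U of index p in W, the quotient R = Q / U has order p^4 and R' = Phi(R) has order p, so the
   center of R is not contained in R'. *)
have [U [sUW nUQ oU]] : exists U : {group coset_of 'L_3(P)},
    [/\ U \subset W, U <| Q & #|U| = (p ^ k.-1)%N].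
  by apply: normal_pgroup => //; apply: leq_pred.
pose R := (Q / U)%G.
have R'W : R^`(1) = W / U by rewrite /= -quotient_der ?normal_norm // Q'W.
have oWU : #|W / U| = p.
  rewrite card_quotient ?(subset_trans sWQ) ?normal_norm // -divgS // oW oU.
  by rewrite -expnB ?leq_pred ?prime_gt0 // -{1}(ltn_predK k_gt1) subSnn expn1.
have oR : #|R| = (p ^ 4)%N.
  apply/eqP; rewrite -(eqn_pmul2l (cardG_gt0 U)) card_quotient ?normal_norm //.
  rewrite Lagrange ?normal_sub // oQ oU oW -!expnD eqn_exp2l //.
  by case: (k) k_gt1 => // n _; rewrite !(addnS, addSn) addn0.
have [rb Zrb R'rb] : exists2 rb, rb \in 'Z(R) & rb \notin W / U.
  apply/subsetPn; rewrite -R'W.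
  have := center_neq_der1 p_pr (quotient_pgroup U pQ) oR.
  rewrite -(quotient_Phi pQ) ?normal_norm // PhiQ R'W => /(_ erefl oWU).
  rewrite eqEsubset negb_and => /orP[//|/negP[]].
  apply: subset_trans (quotientS U sWZ) _; exact: morphim_center.
have [Rrb cRrb] := setIP Zrb.
have /morphimP[r nUr Qr def_rb] := Rrb.
have Wr : r \notin W.
  by apply: contra R'rb => Wr; rewrite def_rb mem_quotient.
have rU g : g \in Q -> [~ r, g] \in U.
  move=> Qg; have nUg := subsetP (normal_norm nUQ) g Qg.
  rewrite -(coset1_mem nUQ) ?groupR // morphR //= -def_rb; apply/commgP.
  by apply: (centP cRrb); apply: mem_quotient.
(* All conjugates of r lie in the coset r U, which bounds the index of its centralizer. *)
have iC : #|Q : 'C_Q[r]| <= p ^ k.-1.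
  rewrite index_cent1 -oU -(card_lcoset U r); apply/subset_leq_card.
  apply/subsetP=> _ /imsetP[g Qg ->]; rewrite conjg_mulR mem_lcoset mulKg.
  exact: rU.
pose D := (W <*> <[r]>)%G.
have sDQ : D \subset Q by rewrite join_subG sWQ cycle_subG.
have cr : <[r]> \subset 'C(W) by rewrite cycle_subG (subsetP cWQ).
have abW : abelian W by rewrite /abelian (subset_trans sWQ).
have abD : abelian D by rewrite abelianY abW cycle_abelian.
have oD : #|D| <= p ^ 3 by apply: rankP (normal_L 3) sDQ (abelem_quo_L3 sDQ abD).
(* The abelian group D = W<r> properly contains W, and [rankP] bounds its order by p^3. *)
have k2 : k = 2.
  apply/eqP; rewrite eqn_leq k_gt1 andbT -ltnS -(ltn_exp2l _ _ p_gt1) -oW.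
  apply: leq_trans oD; apply: proper_card; rewrite properE joing_subl.
  apply: contra Wr => /subsetP; apply.
  by rewrite (subsetP (joing_subr _ _)) ?cycle_id.
pose C := 'C_Q[r]%G.
have sDC : D \subset C.
  rewrite subsetI sDQ join_subG sub_cent1 cycle_subG cent1id andbT.
  by rewrite (subsetP cWQ).
have oC : p ^ 4 <= #|C|.
  rewrite -(leq_pmul2r (prime_gt0 p_pr)) -expnSr.
  have -> : (p ^ 5)%N = (#|C| * #|Q : C|)%N.
    by rewrite Lagrange ?subsetIl // oQ oW k2 -expnD.
  by rewrite leq_pmul2l ?cardG_gt0 // (leq_trans iC) // k2.
(* The centralizer of r has order at least p^4, so it contains some s outside D; then D<s> is
   elementary abelian of order larger than p^3. *)
have [s Cs Ds] : exists2 s, s \in C & s \notin D.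
  apply/subsetPn; apply/negP=> /subset_leq_card; rewrite leqNgt => /negP[].
  by rewrite (leq_ltn_trans oD) // (leq_trans _ oC) // ltn_exp2l.
have [Qs cs] := setIP Cs.
pose E := (D <*> <[s]>)%G.
have sEQ : E \subset Q by rewrite join_subG sDQ cycle_subG.
have abE : abelian E.
  rewrite abelianY abD cycle_abelian cycle_subG /= centY inE (subsetP cWQ) //=.
  by rewrite cent_cycle.
have := rankP (normal_L 3) sEQ (abelem_quo_L3 sEQ abE); rewrite leqNgt => /negP[].
apply: leq_ltn_trans (_ : #|D| < _); last first.
  apply: proper_card; rewrite properE joing_subl.
  apply: contra Ds => /subsetP; apply.
  by rewrite (subsetP (joing_subr _ _)) ?cycle_id.
have : p ^ 2 < #|D|.
  have -> : (p ^ 2)%N = #|W| by rewrite oW k2.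
  apply: proper_card; rewrite properE joing_subl.
  apply: contra Wr => /subsetP; apply.
  by rewrite (subsetP (joing_subr _ _)) ?cycle_id.
rewrite (card_pgroup (pgroupS sDQ pQ)) ltn_exp2l // => ?.
by rewrite leq_exp2l.
Qed.

(** * Strict descent of the series, [rad], and centralizers of sections of L_2 *)

Lemma index_p_power (M N : {group gT}) : M \subset P -> {k | #|M : N| = (p ^ k)%N}.
Proof. by move=> sMP; apply/p_natP/(pnat_dvd (dvdn_indexg _ _))/(pgroupS sMP). Qed.

Lemma L_strict n : 'L_n.+1(P) != 1 -> ~~ ('L_n.+1(P) \subset 'L_n.+2(P)).
Proof.
move=> ntL; have := @nil_comm_properl _ _ _ P (pgroup_nil pP) (lcn_sub n.+1 P) ntL.
rewrite -lcnSn subsetI subxx lcn_norm => /(_ isT).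
by rewrite properE => /andP[].
Qed.

Lemma L_trivial_le m n : m <= n -> 'L_m(P) = 1 -> 'L_n(P) = 1.
Proof. by move=> le_mn Lm; apply/trivgP; rewrite -Lm lcn_sub_leq. Qed.

Lemma dvd_index_L n : 'L_n.+1(P) != 1 -> p %| #|'L_n.+1(P) : 'L_n.+2(P)|.
Proof.
move=> ntL; have := L_strict ntL.
have [[|k] kE] := index_p_power 'L_n.+2(P) (lcn_sub n.+1 P).
  by rewrite -indexg_eq1 /= kE eqxx.
by rewrite kE expnS dvdn_mulr.
Qed.

(* The subgroups Z and C_P(L_2 / N) of the header. *)
Definition rad := (coset 'L_3(P) @*^-1 'Z(P / 'L_3(P)))%G.
Definition L2cent (N : {group gT}) :=
  (coset N @*^-1 'C_(P / N)('L_2(P) / N))%G.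

Lemma rad_sub : rad \subset P.
Proof. by rewrite sub_cosetpre_quo ?normal_L ?center_sub. Qed.

Lemma L2cent_sub N : N <| P -> L2cent N \subset P.
Proof. by move=> nN; rewrite sub_cosetpre_quo ?subsetIl. Qed.

Lemma in_cosetpre N x (E : {set coset_of N}) :
  N <| P -> x \in P -> (x \in coset N @*^-1 E) = (coset N x \in E).
Proof. by case/andP=> _ nNP Px; rewrite inE (subsetP nNP) //= inE. Qed.

Lemma radP x :
  x \in P -> reflect ({in P, forall y, [~ x, y] \in 'L_3(P)}) (x \in rad).
Proof.
move=> Px; rewrite in_cosetpre ?normal_L // inE mem_quotient //=.
apply: (iffP centP) => [cx y Py | cx _ /morphimP[y _ Py ->]].
  by apply/commute_mod; rewrite ?normal_L //; apply: cx; apply: mem_quotient.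
by apply/commute_mod; rewrite ?normal_L // cx.
Qed.

Lemma L2centP N x : N <| P -> x \in P ->
  reflect ({in 'L_2(P), forall u, [~ u, x] \in N}) (x \in L2cent N).
Proof.
move=> nN Px; rewrite in_cosetpre // inE mem_quotient //=.
apply: (iffP centP) => [cx u Lu | cx _ /morphimP[u _ Lu ->]].
  apply/commute_mod; rewrite ?(L_in Lu) //; apply/commute_sym/cx.
  exact: mem_quotient.
by apply/commute_sym/commute_mod; rewrite ?(L_in Lu) ?cx.
Qed.

Lemma L2_sub_rad : 'L_2(P) \subset rad.
Proof.
by apply/subsetP=> u Lu; apply/radP=> [|y Py]; rewrite ?(L_in Lu) ?comm_L.
Qed.

(** Three subgroups lemma: [rad, P] lies in L_3, hence [rad, P, P] lies in L_4. *)
Lemma comm_rad_L2 : [~: 'L_2(P), rad] \subset 'L_4(P).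
Proof.
have sR : [~: rad, P] \subset 'L_3(P).
  rewrite gen_subG; apply/subsetP=> _ /imset2P[x y Rx Py ->].
  by apply/radP => //; apply: (subsetP rad_sub).
have nR := subset_trans rad_sub (lcn_norm 4 P).
rewrite lcn2; apply: three_subgroup_mod; rewrite ?lcn_norm //.
  by rewrite (commGC P); apply: (commSg P sR).
exact: (commSg P sR).
Qed.

(** * Indices of [rad], of centralizers and of L_4 when L_3 is nontrivial *)

Section ClassThree.

Hypothesis ntL3 : 'L_3(P) != 1.

Lemma index_L2_L3 : #|'L_2(P) : 'L_3(P)| = p.
Proof.
have ntL2 : 'L_2(P) != 1.
  by apply: contra ntL3 => /eqP L2; apply/eqP/(L_trivial_le _ L2).
apply/eqP; rewrite eqn_leq index_L2_L3_le dvdn_leq ?indexg_gt0 //.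
exact: dvd_index_L.
Qed.

Lemma L2_gen : exists2 c, c \in 'L_2(P) & 'L_2(P) \subset 'L_3(P) * <[c]>.
Proof.
have /subsetPn[c Lc L3c] : ~~ ('L_2(P) \subset 'L_3(P)).
  by rewrite -indexg_eq1 index_L2_L3 neq_ltn prime_gt1 ?orbT.
exists c => //; apply: prime_index_sub_mul => //; first exact: lcn_normalS.
by rewrite index_L2_L3.
Qed.

(** Q = P / L_3 has order p^4 and |Q'| = p, so [center_neq_der1] gives a center of order at least
    p^2. Index 1 or p would make Q abelian. *)
Lemma index_rad : #|P : rad| = (p ^ 2)%N.
Proof.
have p_gt1 := prime_gt1 p_pr.
rewrite index_cosetpre_quo ?normal_L //.
pose Q := (P / 'L_3(P))%G; rewrite -/Q; have pQ : p.-group Q by apply: quotient_pgroup.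
have oW : #|'L_2(P) / 'L_3(P)| = p by rewrite card_quo_L index_L2_L3.
have Q'W : Q^`(1) = 'L_2(P) / 'L_3(P) by rewrite -quotient_der ?lcn_norm.
have PhiQ : 'Phi(Q) = Q^`(1) by rewrite Q'W -(quotient_Phi pP) ?lcn_norm // -L2_Phi.
have oQ : #|Q| = (p ^ 4)%N.
  by rewrite card_quotient ?lcn_norm // index_P_L index_L2_L3 -expnSr.
have [k kE] := p_natP (pnat_dvd (dvdn_indexg Q 'Z(Q)) pQ).
have Z_gt : p < #|'Z(Q)|.
  rewrite -[X in X < _]oW; apply: proper_card.
  rewrite properEneq center_quo_L3 andbT eq_sym -Q'W.
  by apply: (center_neq_der1 p_pr pQ oQ PhiQ); rewrite Q'W.
have oZ := Lagrange (center_sub Q); rewrite kE oQ in oZ.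
have k_le : k <= 2.
  rewrite -ltnS -(ltn_exp2l _ _ p_gt1) -(ltn_pmul2l (prime_gt0 p_pr)) -(expnS p 3) -oZ.
  by rewrite ltn_pmul2r // expn_gt0 prime_gt0.
rewrite kE; case: k kE k_le {oZ} => [|[|[|]]] // kE _.
all: suff abQ : abelian Q by move: p_gt1; rewrite -oW -Q'W (derG1P abQ) cards1.
all: apply: cyclic_center_factor_abelian.
  rewrite (_ : Q / 'Z(Q) = 1) ?cyclic1 //; apply/eqP.
  by rewrite trivg_card1 card_quotient ?kE // normal_norm ?center_normal.
by apply: prime_cyclic; rewrite card_quotient ?kE // normal_norm ?center_normal.
Qed.

Lemma index_rad_L2 : #|rad : 'L_2(P)| = p.
Proof.
have oL2 : #|P : 'L_2(P)| = (p ^ 3)%N by rewrite L2_Phi.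
have := Lagrange_index rad_sub L2_sub_rad; rewrite index_rad oL2 => /eqP.
by rewrite (expnSr p 2) eqn_pmul2l ?expn_gt0 ?prime_gt0 // => /eqP.
Qed.

Lemma rad_not_L2 : exists2 z, z \in rad & z \notin 'L_2(P).
Proof.
by apply/subsetPn; rewrite -indexg_eq1 index_rad_L2 neq_ltn prime_gt1 ?orbT.
Qed.

Section Cent.

Variable N : {group gT}.
Hypotheses (nN : N <| P) (sL4N : 'L_4(P) \subset N) (sNL3 : N \subset 'L_3(P)).

(** Modulo the central L_3 / N, the group L_2 / N is generated by one element c, so
    [card_commg_cyclic_center] applies to its commutator with P / N, which is L_3 / N. *)
Lemma index_L2cent : #|P : L2cent N| = #|'L_3(P) : N|.
Proof.
have nNP := normal_norm nN; have [c Lc sL2c] := L2_gen.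
rewrite index_cosetpre_quo //.
have nNL n := subset_trans (lcn_sub n P) nNP.
have oL3 : #|'L_3(P) : N| = #|[~: 'L_2(P) / N, P / N]|.
  by rewrite -quotientR ?nNL // (card_quotient (nNL 3)).
rewrite oL3; apply/esym/(@card_commg_cyclic_center _ _ _ ('L_3(P) / N)%G (coset N c)).
- rewrite subsetI quotientS ?lcn_sub //= quotient_cents2r //.
- exact: mem_quotient.
- exact: quotientS (lcn_sub _ _).
- rewrite -quotient_cycle ?(subsetP (nNL 2)) // -quotientMl ?quotientS //.
  exact: nNL.
- by rewrite -(quotientR (nNL 2) nNP).
Qed.

Lemma rad_sub_L2cent : rad \subset L2cent N.
Proof.
apply/subsetP=> x Rx; have Px := subsetP rad_sub x Rx.
apply/L2centP => // u Lu; apply: (subsetP sL4N).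
by apply: (subsetP comm_rad_L2); apply: mem_commg.
Qed.

End Cent.

(** This index is that of the centralizer of L_2 / L_4, which contains [rad], of index p^2. *)
Lemma index_L3_L4 : #|'L_3(P) : 'L_4(P)| <= p ^ 2.
Proof.
rewrite -(index_L2cent (normal_L 4)) ?lcn_subS // -index_rad.
apply: dvdn_leq; rewrite ?indexg_gt0 //; apply: indexgS.
exact: rad_sub_L2cent (normal_L 4) (subxx _).
Qed.

End ClassThree.

(** The argument of [expp_L3] one step lower: u^p lies in L_3, where a acts as l^3 modulo L_4,
    whereas expanding a u gives l^2. *)
Lemma L2_expp u : u \in 'L_2(P) -> u ^+ p \in 'L_4(P).
Proof.
move=> Lu; have Pu := L_in Lu; have L3up := expp_L3 Pu.
have := a_coset_L (normal_L 3) (subxx _) Lu; rewrite -cosetX ?normal_L //.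
case/(coset_eqP (normal_L 3) (a_in Pu) (groupX _ Pu)) => h Lh au.
have Ph := L_in Lh; rewrite -(coset1_mem (normal_L 4)) ?groupX //.
apply/eqP/(expg_ncongr_eq1 p_pr (m := (l ^ 2 * l)%N) (n := (l ^ 2)%N)
  (x := coset 'L_4(P) (u ^+ p))).
- rewrite -{2}[(l ^ 2)%N]muln1 => E; apply: l1; apply: modn_cancel p_pr _ E.
  by rewrite Euclid_dvdX // andbT p_l.
- exact: coset_expp (normal_L 4) (subxx _) L3up.
- rewrite -expnSr -(a_coset_L (normal_L 4) (subxx _)) // aX // au.
  rewrite !cosetX ?normal_L ?groupM ?groupX // cosetM ?normal_L ?groupX //.
  rewrite expgMn; last first.
    by apply/commute_sym/(central_L (normal_L 4) (subxx _) Lh); apply: groupX.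
  by rewrite (coset_expp (normal_L 4) (subxx _) Lh) mulg1 cosetX ?normal_L // expgAC.
Qed.

Lemma normal_index_p n : 'L_n.+1(P) != 1 -> exists N : {group gT},
  [/\ N <| P, 'L_n.+2(P) \subset N, N \subset 'L_n.+1(P)
    & #|'L_n.+1(P) : N| = p].
Proof.
move=> ntL; pose Q := (P / 'L_n.+2(P))%G; pose W := ('L_n.+1(P) / 'L_n.+2(P))%G.
have pQ : p.-group Q by apply: quotient_pgroup.
have nWQ : W <| Q by apply: quotient_normal; apply: lcn_normal.
have oW : #|W| = #|'L_n.+1(P) : 'L_n.+2(P)|.
  by rewrite card_quotient ?(subset_trans (lcn_sub _ _)) ?lcn_norm.
have oW' := card_pgroup (pgroupS (normal_sub nWQ) pQ).
have k_gt0 : 0 < logn p #|W|.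
  by rewrite logn_gt0 mem_primes p_pr cardG_gt0 oW dvd_index_L.
have [U [sUW nUQ oU]] : exists U : {group coset_of 'L_n.+2(P)},
    [/\ U \subset W, U <| Q & #|U| = (p ^ (logn p #|W|).-1)%N].
  by apply: normal_pgroup => //; apply: leq_pred.
exists (coset 'L_n.+2(P) @*^-1 U)%G; split.
- by rewrite cosetpre_normal_quo ?normal_L.
- exact: sub_cosetpre.
- by rewrite sub_cosetpre_quo // lcn_normalS.
rewrite index_cosetpre_quo ?lcn_normalS // -divgS // [X in X %/ _]oW'.
rewrite oU -expnB ?leq_pred ?prime_gt0 //.
by rewrite -{1}(ltn_predK k_gt0) subSnn expn1.
Qed.

Lemma index_P_mid (N : {group gT}) : 'L_3(P) != 1 -> N \subset 'L_3(P) ->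
  #|P : N| = (p ^ 4 * #|'L_3(P) : N|)%N.
Proof.
move=> ntL3 sNL; rewrite -(Lagrange_index (lcn_sub 3 P) sNL) index_P_L.
by rewrite index_L2_L3 // -expnSr.
Qed.

(** * Sections L_3 / N of order p, and the case l^2 <> 1 *)

Section Mid.

Hypothesis ntL3 : 'L_3(P) != 1.
Variable N : {group gT}.
Hypotheses (nN : N <| P) (sL4N : 'L_4(P) \subset N) (sNL3 : N \subset 'L_3(P)).
Hypothesis iL3N : #|'L_3(P) : N| = p.

Let sA := L2cent_sub nN.

Lemma index_L2cent_rad : #|L2cent N : rad| = p.
Proof.
have := Lagrange_index sA (rad_sub_L2cent nN sL4N).
rewrite index_rad // index_L2cent // iL3N => /eqP.
by rewrite -mulnn eqn_pmul2l ?prime_gt0 // => /eqP.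
Qed.

(** Modulo L_3, [rad] is central and has index p in [L2cent N], so the quotient is abelian. *)
Lemma L2cent_comm_L3 x y : x \in L2cent N -> y \in L2cent N -> [~ x, y] \in 'L_3(P).
Proof.
move=> Ax Ay; have [Px Py] := (subsetP sA x Ax, subsetP sA y Ay).
apply/(commute_mod (normal_L 3) Px Py).
have nA3 := subset_trans sA (lcn_norm 3 P).
have sRA := rad_sub_L2cent nN sL4N.
suff /centsP cA : abelian (L2cent N / 'L_3(P)) by apply: cA; apply: mem_quotient.
apply: (@cyclic_factor_abelian _ (rad / 'L_3(P))%G).
  rewrite subsetI quotientS //= cosetpreK.
  by rewrite centsC (subset_trans (quotientS _ sA)) // centsC subsetIr.
apply: prime_cyclic; rewrite card_quotient ?index_quotient_eq //.
- by rewrite index_L2cent_rad.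
- by rewrite (subset_trans (subsetIr _ _)) // sub_cosetpre.
rewrite quotient_norms // normal_norm // (normalS sRA sA) //.
by rewrite cosetpre_normal_quo ?normal_L ?center_normal.
Qed.

(** Commutators and p-th powers fall into L_3 / N, where a acts as l^3. As L_2 is central modulo N
    here, expanding a x and a y gives l^2 on [x, y] and l on x^p; both differ from l^3, the first by
    l <> 1 and the second by l^2 <> 1. *)
Lemma abelem_L2cent : l * l <> 1 %[mod p] -> p.-abelem (L2cent N / N).
Proof.
move=> l2.
have sL2A := subset_trans L2_sub_rad (rad_sub_L2cent nN sL4N).
have cA x u : x \in L2cent N -> u \in 'L_2(P) -> commute (coset N u) (coset N x).
  move=> Ax Lu; have Px := subsetP sA x Ax.
  apply/commute_mod => //; first exact: (L_in Lu).
  by have /(L2centP nN Px) := Ax; apply.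
have pL3 w : w \in 'L_3(P) -> coset N w ^+ p = 1.
  by move=> Lw; apply: coset_expp nN sL4N Lw.
apply/abelemP => //; split.
  apply/centsP=> _ /morphimP[x _ Ax ->] _ /morphimP[y _ Ay ->] /=.
  have [Px Py] := (subsetP sA x Ax, subsetP sA y Ay).
  have Lxy := L2cent_comm_L3 Ax Ay.
  apply/commgP; rewrite -cosetR //.
  apply/eqP/(expg_ncongr_eq1 p_pr (m := (l ^ 2 * l)%N) (n := (l ^ 2)%N)
    (x := coset N [~ x, y])) => //.
  - rewrite -{2}[(l ^ 2)%N]muln1 => E; apply: l1; apply: modn_cancel p_pr _ E.
    by rewrite Euclid_dvdX // andbT p_l.
  - exact: pL3.
  rewrite -expnSr -(a_coset_L nN sL4N Lxy) aR // cosetR ?a_in //.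
  have [[u Lu ->] [v Lv ->]] := (a_expand Px, a_expand Py).
  rewrite (cosetM nN (groupX l Px) (L_in Lu)) (cosetM nN (groupX l Py) (L_in Lv)).
  rewrite (cosetX l nN Px) (cosetX l nN Py).
  have cxy : commute (coset N [~ x, y]) (coset N x) by apply: central_L nN sL4N Lxy Px.
  have cyx : commute (coset N [~ x, y]) (coset N y) by apply: central_L nN sL4N Lxy Py.
  rewrite commg_mul_commute; try (apply: commuteX); try (exact: cA).
    rewrite cosetR // in cxy cyx *.
    rewrite commXg; last first.
      by rewrite commgX; [apply: commuteX; apply: commute_sym | apply: commute_sym].
    by rewrite commgX -?expgM ?mulnn //; apply: commute_sym.
  by apply: cA => //; apply: (subsetP sL2A).
move=> _ /morphimP[x _ Ax ->] /=; have Px := subsetP sA x Ax.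
have Lw := expp_L3 Px; rewrite -cosetX //.
apply/(expg_ncongr_eq1 p_pr (m := (l * (l * l))%N) (n := l)
    (x := coset N (x ^+ p))) => //.
- by rewrite -{4}[l]muln1 => /(modn_cancel p_pr p_l).
- exact: pL3.
rewrite mulnn -expnS -(a_coset_L nN sL4N Lw) aX //.
have [u Lu ->] := a_expand Px; have Pu := L_in Lu.
rewrite !(cosetX _ nN) ?groupM ?groupX // (cosetM nN) ?groupX // expgMn.
  have -> : coset N u ^+ p = 1.
    by rewrite -cosetX //; apply/coset_id/(subsetP sL4N)/L2_expp.
  by rewrite mulg1 cosetX // expgAC.
by rewrite cosetX //; apply/commute_sym/commuteX/cA.
Qed.

End Mid.

Lemma L3_trivial : l * l <> 1 %[mod p] -> 'L_3(P) = 1.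
Proof.
move=> l2; apply/eqP/idPn => ntL3.
have [N [nN sL4N sNL3 iN]] := normal_index_p ntL3.
have := rankP nN (quotientS N (L2cent_sub nN)) (abelem_L2cent ntL3 nN sL4N iN l2).
rewrite card_quotient ?(subset_trans (L2cent_sub nN)) ?normal_norm //.
have sNA : N \subset L2cent N.
  apply: subset_trans sNL3 (subset_trans (lcn_subS 2 P) _).
  exact: subset_trans L2_sub_rad (rad_sub_L2cent nN sL4N).
(* |P : N| = p^5 and |P : L2cent N| = p, so the elementary abelian section has order p^4. *)
have := Lagrange_index (L2cent_sub nN) sNA.
rewrite (index_P_mid ntL3 sNL3) index_L2cent // iN -expnSr (expnS p 4) => /eqP.
rewrite eqn_pmul2l ?prime_gt0 // => /eqP->.
by rewrite leq_exp2l ?prime_gt1.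
Qed.

(** * The case l = -1: elements inverted by a *)

Section Involution.

Hypothesis a2 : forall x, a (a x) = x.
Hypothesis l2 : l * l = 1 %[mod p].
Hypothesis p_gt2 : 2 < p.

Lemma expg_l (rT : finGroupType) (y : rT) : y ^+ p = 1 -> y ^+ l = y^-1.
Proof.
move=> yp; apply/eqP; rewrite eq_sym eq_invg_mul -expgS; apply/eqP.
have l_gt0 : 0 < l by rewrite lt0n; apply: contraNneq p_l => ->.
(* p divides (l - 1)(l + 1) but not l - 1, so the power l is inversion on elements of exponent p. *)
have : p %| l.+1; last by case/dvdnP=> k ->; rewrite mulnC expgM yp expg1n.
have /eqP := l2; rewrite eqn_mod_dvd ?muln_gt0 ?l_gt0 //.
have -> : (l * l - 1 = (l - 1) * l.+1)%N.
  by rewrite -[l.+1]addn1 -subn_sqr exp1n mulnn.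
by rewrite Euclid_dvdM // -eqn_mod_dvd // => /orP[/eqP/l1|].
Qed.

Lemma expg_l3 (rT : finGroupType) (y : rT) : y ^+ p = 1 -> y ^+ (l ^ 3) = y^-1.
Proof.
move=> yp; rewrite -(expg_l yp); apply: expg_congr yp.
by rewrite expnS -modnMmr -mulnn l2 modnMmr muln1.
Qed.

Lemma a_L3_inv N w : N <| P -> 'L_4(P) \subset N -> w \in 'L_3(P) ->
  coset N (a w) = (coset N w)^-1.
Proof.
move=> nN sLN Lw; rewrite (a_coset_L nN sLN Lw); apply: expg_l3.
exact: coset_expp nN sLN Lw.
Qed.

Lemma sqr_expp_mem H x : x ^+ 2 \in H -> x ^+ p \in H -> x \in H.
Proof.
move=> Hx2; rewrite -{1}(odd_double_half p) expgD -mul2n expgM.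
have -> : odd p.
  by case: (even_prime p_pr) => // p2; move: p_gt2; rewrite p2.
by rewrite groupMr // groupX.
Qed.

(** Since a is an involution, it swaps x and a x, hence inverts x (a x)^-1. The result avoids H
    because p is odd: x is a product of powers of x^2 and of x^p, which is in L_2. *)
Lemma exists_inverted H x : 'L_2(P) \subset H -> x \in P -> x \notin H ->
  exists y, [/\ y \in P, y \notin H, a y = y^-1
    & exists2 u, u \in 'L_2(P) & y = x ^+ 2 * u].
Proof.
move=> sLH Px Hx; exists (x * (a x)^-1); have Pax := a_in Px.
have [u Lu def_y] : exists2 u, u \in 'L_2(P) & x * (a x)^-1 = x ^+ 2 * u.
  apply: (coset_eqP (normal_L 2)); rewrite ?groupM ?groupV //.
  rewrite cosetM ?groupV ?normal_L // cosetV ?normal_L //.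
  have -> : coset 'L_2(P) (a x) = coset 'L_2(P) x ^+ l.
    have [v Lv ->] := a_expand Px.
    by rewrite cosetM ?groupX ?normal_L ?(L_in Lv) // (coset_id Lv) mulg1 cosetX ?normal_L.
  rewrite expg_l ?invgK ?cosetM ?normal_L //.
  exact: (@coset_expp 0 _ _ (normal_L 2) (subxx _)).
split; first by rewrite groupM ?groupV.
- apply: contra Hx; rewrite def_y groupMr ?(subsetP sLH u Lu) // => Hx2.
  by apply: sqr_expp_mem => //; apply: (subsetP sLH); apply: (@L_expp 0).
- by rewrite aM ?groupV // aV // a2 invMg invgK.
- by exists u.
Qed.

Lemma pgroup_index_ge H K : H \subset P -> K \proper H -> p * #|K| <= #|H|.
Proof.
move=> sHP; rewrite properEneq => /andP[neKH sKH].
have [[|k] kE] := index_p_power K sHP.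
  by rewrite (index1g sKH) ?eqxx in neKH.
by rewrite mulnC -(Lagrange sKH) leq_pmul2l // kE expnS leq_pmulr // expn_gt0 prime_gt0.
Qed.

(** The conditions are put on generators only: the quotient is abelian, so exponent p and inversion
    spread to all of <<S>> / N. Order p^3 would then contradict [maxP]. *)
Lemma card_inverted_lt N (S : {set gT}) :
    N <| P -> {in N, forall x, a x \in N} -> S \subset P -> N \subset <<S>> ->
    {in S &, forall x y, [~ x, y] \in N} -> {in S, forall x, x ^+ p \in N} ->
    {in S, forall x, coset N (a x) = (coset N x)^-1} -> p ^ 3 < #|P : N| ->
  #|<<S>> : N| < p ^ 3.
Proof.
move=> nN aN sSP sNS cS expS invS iN; have nNP := normal_norm nN.
have sHP : <<S>> \subset P by rewrite gen_subG.
have nNS := subset_trans sSP nNP; have nNH := subset_trans sHP nNP.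
have abH : abelian (<<S>> / N).
  rewrite quotient_gen // abelian_gen.
  apply/centsP=> _ /morphimP[x _ Sx ->] _ /morphimP[y _ Sy ->].
  by apply/(commute_mod nN); rewrite ?(subsetP sSP) ?cS.
have cH x y : x \in <<S>> -> y \in <<S>> -> commute (coset N x) (coset N y).
  by move=> Hx Hy; apply: (centsP abH); apply: mem_quotient.
have exH x : x \in <<S>> -> coset N x ^+ p = 1.
  move=> Hx; apply/eqP; move: x Hx.
  apply: (gen_ind (Q := fun x => coset N x ^+ p == 1)).
  - by rewrite coset_id ?expg1n.
  - move=> x Sx; rewrite -cosetX ?(subsetP sSP) //.
    by rewrite coset_id ?expS.
  - move=> x y Hx Hy /eqP xp /eqP yp.
    rewrite (cosetM nN) ?(subsetP sHP) // expgMn ?xp ?yp ?mulg1 //.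
    exact: cH.
have invH x : x \in <<S>> -> coset N (a x) = (coset N x)^-1.
  move=> Hx; apply/eqP; move: x Hx.
  apply: (gen_ind (Q := fun x => coset N (a x) == (coset N x)^-1)).
  - by rewrite coset_id ?aN // coset_id // invg1.
  - by move=> x Sx; rewrite invS.
  - move=> x y Hx Hy /eqP ax /eqP ay.
    have [Px Py] := (subsetP sHP x Hx, subsetP sHP y Hy).
    rewrite aM // !(cosetM nN) ?a_in // ax ay -invMg; apply/eqP; congr _^-1.
    exact: cH.
have elH : p.-abelem (<<S>> / N).
  by apply/abelemP=> //; split=> // _ /morphimP[x _ Hx ->]; apply: exH.
have oH := card_quotient nNH.
have le3 : #|<<S>> : N| <= p ^ 3 by rewrite -oH; apply: rankP nN (quotientS N sHP) elH.
rewrite ltn_neqAle le3 andbT; apply/eqP => o3.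
(* The power p - 1 is inversion in exponent p, and p > 2 keeps it different from 1 modulo p. *)
apply: (@maxP N (<<S>> / N)%G p.-1) => //; last 2 first.
- move=> E; have := E; rewrite -(prednK (prime_gt0 p_pr)) => /eqP.
  by rewrite !modn_small ?(ltn_predK p_gt2) //; case: (p) p_gt2 => [|[|[|]]].
- move=> x Px /morphimP[y _ Hy xy]; rewrite (a_congr nN aN Px _ xy) ?(subsetP sHP) //.
  rewrite xy invH //; apply/eqP; rewrite eq_sym -(inj_eq (mulgI (coset N y))).
  by rewrite -expgS (prednK (prime_gt0 p_pr)) mulgV exH.
- rewrite properEneq quotientS // andbT; apply/eqP => E.
  by move: iN; rewrite -card_quotient // -E oH o3 ltnn.
- by rewrite oH.
Qed.

(** * An inverted element z of [rad] outside L_2 *)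

Section Inverted.

Hypothesis ntL3 : 'L_3(P) != 1.
Variable z : gT.
Hypotheses (Rz : z \in rad) (L2z : z \notin 'L_2(P)) (az : a z = z^-1).

Let Pz : z \in P := subsetP rad_sub z Rz.

Lemma rad_comm_L2 x u : x \in rad -> u \in 'L_2(P) -> [~ x, u] \in 'L_4(P).
Proof.
move=> Rx Lu; have Px := subsetP rad_sub x Rx.
apply/(commute_mod (normal_L 4) Px (L_in Lu))/commute_sym.
apply/(commute_mod (normal_L 4) (L_in Lu) Px); apply: (subsetP comm_rad_L2).
exact: mem_commg.
Qed.

(** Modulo L_4, a [z, y] = [z^-1, y^l u] = [z, y], since u commutes with z and the power l inverts.
    But a inverts L_3 / L_4, so [z, y]^2 = 1 there, and p is odd. *)
Lemma inverted_comm_L4 y : y \in P -> [~ z, y] \in 'L_4(P).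
Proof.
move=> Py; have L3zy : [~ z, y] \in 'L_3(P) by apply/radP.
have Pzy := L_in L3zy; have [u Lu ay] := a_expand Py; have Pu := L_in Lu.
have n4 := normal_L 4.
have c w : w \in P ->
    commute (coset 'L_4(P) [~ z, y]) (coset 'L_4(P) w).
  exact: central_L n4 (subxx _) L3zy.
have exp1 : coset 'L_4(P) [~ z, y] ^+ p = 1 by apply: coset_expp n4 (subxx _) L3zy.
have invc : coset 'L_4(P) (a [~ z, y]) = coset 'L_4(P) [~ z, y].
  rewrite aR // az ay !(cosetR n4) ?groupM ?groupX ?groupV //.
  rewrite (cosetM n4) ?groupX // cosetV // cosetX //.
  set zb := coset _ z; set yb := coset _ y; set ub := coset _ u.
  have zu : [~ zb^-1, ub] = 1.
    apply/eqP/commgP/commute_sym/commuteV/commute_sym.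
    by apply/(commute_mod n4) => //; apply: rad_comm_L2.
  have cz : commute [~ zb, yb] zb by rewrite -cosetR //; apply: c.
  have cy : commute [~ zb, yb] yb by rewrite -cosetR //; apply: c.
  have cu : commute [~ zb, yb] ub by rewrite -cosetR //; apply: c.
  have yl : [~ zb, yb ^+ l] = [~ zb, yb]^-1.
    by rewrite (commgX l (commute_sym cy)) expg_l // -cosetR.
  have zV : [~ zb^-1, yb ^+ l] = [~ zb, yb].
    have : [~ zb * zb^-1, yb ^+ l] = 1 by rewrite mulgV comm1g.
    rewrite commMgJ yl conjVg conjgE invgK (commuteV cz) mulKVg => /eqP.
    by rewrite -eq_invg_mul invgK => /eqP.
  rewrite commgMJ zu mul1g zV conjgE cu.
  by rewrite mulKg.
rewrite -(coset1_mem n4) //; apply/eqP.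
apply: (expg_ncongr_eq1 p_pr (m := 2) (n := 0)) exp1 _.
  by rewrite modn_small // mod0n.
rewrite expgS expg1 -{2}invc (a_L3_inv n4 (subxx _)) // mulgV //.
Qed.

Lemma zp_L3 : z ^+ p \in 'L_3(P). Proof. exact: expp_L3. Qed.

(* The subgroup T of the header. *)
Definition zpL4 := ('L_4(P) <*> <[z ^+ p]>)%G.

Lemma zpL4_sub : zpL4 \subset 'L_3(P).
Proof. by rewrite join_subG lcn_subS cycle_subG zp_L3. Qed.

Lemma L4_sub_zpL4 : 'L_4(P) \subset zpL4.
Proof. exact: joing_subl. Qed.

Lemma zpL4_normal : zpL4 <| P.
Proof.
rewrite /normal (subset_trans zpL4_sub) ?lcn_sub //= -commg_subl.
by apply: subset_trans (commSg P zpL4_sub) L4_sub_zpL4.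
Qed.

(** For the generator z^p: [z, x] is in L_4, hence central of exponent p modulo L_5, and [z^p, x] =
    [z, x]^p. *)
Lemma zpL4_comm t x : t \in zpL4 -> x \in P -> [~ t, x] \in 'L_5(P).
Proof.
move=> Tt Px; have n5 := normal_L 5.
have Pt : t \in P by apply: (L_in (subsetP zpL4_sub t Tt)).
apply/(commute_mod n5 Pt Px).
suff /subsetP/(_ t Tt) : zpL4 \subset coset 'L_5(P) @*^-1 'C[coset 'L_5(P) x].
  by rewrite in_cosetpre // => /cent1P.
rewrite join_subG cycle_subG; apply/andP; split.
  apply/subsetP=> w Lw; rewrite in_cosetpre ?(L_in Lw) //; apply/cent1P.
  exact: central_L n5 (subxx _) Lw Px.
rewrite in_cosetpre ?groupX //; apply/cent1P/commute_mod; rewrite ?groupX //.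
have L4zx := inverted_comm_L4 Px.
rewrite -(coset1_mem n5) ?groupR ?groupX // cosetR ?groupX // cosetX //.
have c w : w \in P -> commute (coset 'L_5(P) [~ z, x]) (coset 'L_5(P) w).
  exact: central_L n5 (subxx _) L4zx.
rewrite commXg -?cosetR //; last by apply/commute_sym/c.
by apply/eqP/(coset_expp n5 (subxx _) L4zx).
Qed.

Lemma zpL4_gen : zpL4 \subset 'L_4(P) * <[z ^+ p]>.
Proof.
rewrite /= norm_joinEr // cycle_subG (subsetP (lcn_norm 4 P)) ?groupX //.
Qed.

Lemma index_zpL4_L4 : #|zpL4 : 'L_4(P)| %| p.
Proof.
have n4 := lcn_norm 4 P; have Pzp : z ^+ p \in P by rewrite groupX.
rewrite -card_quotient; last first.
  by rewrite (subset_trans zpL4_sub) // (subset_trans (lcn_sub _ _)).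
rewrite quotientYidl ?cycle_subG ?(subsetP n4) //.
rewrite quotient_cycle ?(subsetP n4) // -orderE order_dvdn.
exact/eqP/(coset_expp (normal_L 4) (subxx _) zp_L3).
Qed.

(** Class 2 power formula: u^p vanishes by [L2_expp], and p divides 'C(p, 2) as p is odd. *)
Lemma expp_mul_L2 x u : x \in P -> u \in 'L_2(P) ->
  coset 'L_4(P) ((x * u) ^+ p) = coset 'L_4(P) (x ^+ p).
Proof.
move=> Px Lu; have Pu := L_in Lu; have n4 := normal_L 4.
have L3ux : [~ u, x] \in 'L_3(P) by apply: comm_L.
rewrite !cosetX ?groupM // cosetM // expMg_Rmul; last 2 first.
- by rewrite -cosetR //; apply/commute_sym/(central_L n4 (subxx _) L3ux).
- by rewrite -cosetR //; apply/commute_sym/(central_L n4 (subxx _) L3ux).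
rewrite -cosetR // -[coset _ u ^+ p]cosetX // (coset_id (L2_expp Lu)) mulg1.
have /dvdnP[k ->] : p %| 'C(p, 2) by rewrite prime_dvd_bin.
rewrite mulnC expgM (coset_expp n4 (subxx _) L3ux).
by rewrite expg1n mulg1.
Qed.

(** * Powers modulo L_4 when L_3 / L_4 has order p^2 *)

Section BigL3.

Hypothesis iL34 : #|'L_3(P) : 'L_4(P)| = (p ^ 2)%N.

(** Otherwise an inverted k = x^2 u outside L_2 also has k^p in L_4, and <k>L_3 / L_4 violates
    [card_inverted_lt]. *)
Lemma expp_L4_L2 x : x \in P -> x ^+ p \in 'L_4(P) -> x \in 'L_2(P).
Proof.
move=> Px L4xp; apply: contraT => L2x; have n4 := normal_L 4.
have [k [Pk L2k ak [u Lu def_k]]] := exists_inverted (subxx _) Px L2x.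
have L4kp : k ^+ p \in 'L_4(P).
  rewrite -(coset1_mem n4) ?groupX // def_k expp_mul_L2 ?groupX //.
  by rewrite -expgM mulnC expgM coset_id // groupX.
pose S := k |: 'L_3(P).
have sL3S : 'L_3(P) \subset <<S>> by apply: sub_gen; apply: subsetUr.
have sSP : S \subset P by rewrite subUset sub1set Pk lcn_sub.
have sHP : <<S>> \subset P by rewrite gen_subG.
have sL4S := subset_trans (lcn_subS 3 P) sL3S.
suff: p ^ 3 <= #|<<S>> : 'L_4(P)|.
  rewrite leqNgt card_inverted_lt //.
  - exact: a_L.
  - move=> x1 x2 /setU1P[->|Lx1] /setU1P[->|Lx2].
    + by rewrite commgg group1.
    + rewrite -invg_comm groupV; exact: comm_L.
    + exact: comm_L.
    + by apply: comm_L; rewrite ?(L_in Lx2).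
  - by move=> x1 /setU1P[->|Lx1] //; apply: L_expp.
  - move=> x1 /setU1P[->|Lx1]; first by rewrite ak cosetV.
    exact: a_L3_inv n4 (subxx _) Lx1.
  - rewrite index_P_mid ?lcn_subS // iL34 -expnD ltn_exp2l ?prime_gt1 //.
have ltS : 'L_3(P) \proper <<S>>.
  rewrite properE sL3S; apply: contra L2k => /subsetP sSL.
  by apply/L_S/sSL; rewrite mem_gen // setU11.
have := pgroup_index_ge sHP ltS.
rewrite -(Lagrange (lcn_subS 3 P)) -(Lagrange sL4S) mulnCA leq_pmul2l //.
by rewrite iL34 -expnS.
Qed.

(** If x^p = z^(p i) modulo L_4, then x z^-i has its p-th power in L_4, because z is central there;
    by [expp_L4_L2] it lies in L_2, and both L_2 and z are in [rad]. *)
Lemma expp_zpL4_rad x : x \in P -> x ^+ p \in zpL4 -> x \in rad.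
Proof.
move=> Px /(subsetP zpL4_gen)/mulsgP[w _ Lw /cycleP[i ->] xp].
have n4 := normal_L 4; pose zi := z ^+ i; have Pzi : zi \in P by apply: groupX.
rewrite -(groupMr x (groupVr (groupX i Rz))); apply: (subsetP L2_sub_rad).
apply: expp_L4_L2; first by rewrite groupM ?groupV.
rewrite -(coset1_mem n4) ?groupX ?groupM ?groupV // cosetX ?groupM ?groupV //.
rewrite cosetM ?groupV // expgMn; last first.
  rewrite cosetV ?cosetX //; apply/commuteV/commuteX/commute_sym.
  by apply/(commute_mod n4) => //; apply: inverted_comm_L4.
rewrite -!cosetX ?groupV // xp cosetM ?(L_in Lw) ?groupX // (coset_id Lw) mul1g.
by rewrite -cosetM ?groupX ?groupV // expgVn -!expgM mulnC mulgV coset_id.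
Qed.

Lemma index_L3_zpL4_big : #|'L_3(P) : zpL4| = p.
Proof.
have := Lagrange_index zpL4_sub L4_sub_zpL4; rewrite iL34.
have /primeP[_ /(_ _ index_zpL4_L4)/orP[|/eqP->]] := p_pr; last first.
  by rewrite -mulnn => /eqP; rewrite eqn_pmul2r ?prime_gt0 // => /eqP.
rewrite indexg_eq1 join_subG cycle_subG => /andP[_ L4zp].
by have := L2z; rewrite (expp_L4_L2 Pz L4zp).
Qed.

End BigL3.

(** Modulo L_5, the subgroup L_3 is central in L_2 with cyclic quotient of order p. *)
Lemma comm_L2_L2 : [~: 'L_2(P), 'L_2(P)] \subset 'L_5(P).
Proof.
have n5 := subset_trans (lcn_sub 2 P) (lcn_norm 5 P).
rewrite -quotient_cents2 //; apply: (@cyclic_factor_abelian _ ('L_3(P) / 'L_5(P))%G).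
  by rewrite subsetI quotientS ?lcn_subS //= quotient_cents2r ?comm_L_L2.
apply: prime_cyclic; rewrite card_quotient; last first.
  by rewrite quotient_norms // normal_norm // lcn_normalS.
rewrite index_quotient_eq ?index_L2_L3 ?lcn_subS //.
by rewrite (subset_trans (subsetIr _ _)) // lcn_sub_leq.
Qed.

(** * The centralizer A of L_2 / T when T has index p in L_3 *)

Section ZpIndex.

Hypothesis iT : #|'L_3(P) : zpL4| = p.

Let nT := zpL4_normal.
Let sL4T := L4_sub_zpL4.
Local Notation A := (L2cent zpL4).

Lemma rad_sub_A : rad \subset A. Proof. exact: rad_sub_L2cent. Qed.

Lemma index_A : #|P : A| = p.
Proof. by rewrite index_L2cent // zpL4_sub. Qed.

Lemma notin_A : exists2 x, x \in P & x \notin A.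
Proof.
by apply/subsetPn; rewrite -indexg_eq1 index_A neq_ltn prime_gt1 ?orbT.
Qed.

(** Three subgroups lemma: [P, A, L_2] lies in [L_2, L_2], and [A, L_2, P] in [T, P]; both are
    inside L_5. *)
Lemma comm_L3_A : [~: 'L_3(P), A] \subset 'L_5(P).
Proof.
have n5 := lcn_norm 5 P; have sA := L2cent_sub nT.
have nA5 := subset_trans sA n5.
apply: (@three_subgroup_mod _ P A 'L_2(P)%G) => //=.
- exact: subset_trans (lcn_sub _ _) n5.
- apply: subset_trans comm_L2_L2; apply: commSg.
  by rewrite lcn2; apply: commgS.
have sAT : [~: A, 'L_2(P)] \subset zpL4.
  rewrite commGC gen_subG; apply/subsetP=> _ /imset2P[u x Lu Ax ->].
  by have /L2centP := Ax; apply=> //; apply: (subsetP sA).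
apply: subset_trans (commSg P sAT) _; rewrite gen_subG.
by apply/subsetP=> _ /imset2P[t x Tt Px ->]; apply: zpL4_comm.
Qed.

(* Otherwise x would centralize 'L_3 = <x^p>T modulo 'L_5, as A does. *)
Lemma expp_notin_A x :
  'L_4(P) != 1 -> x \in P -> x \notin A -> x ^+ p \in zpL4.
Proof.
move=> ntL4 Px Ax; apply/idPn => Txp; have /negP[] := L_strict ntL4.
have n5 := normal_L 5; have sA := L2cent_sub nT.
have nTL3 : zpL4 <| 'L_3(P) by apply: normalS zpL4_sub (lcn_sub _ _) nT.
have prT : prime #|'L_3(P) : zpL4| by rewrite iT.
have sL3 := prime_index_sub_mul nTL3 prT (expp_L3 Px) Txp.
have nA : A <| P.
  rewrite cosetpre_normal_quo // norm_normalI // norms_cent //.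
  by rewrite quotient_norms // lcn_norm.
have prA : prime #|P : A| by rewrite index_A.
have sPA := prime_index_sub_mul nA prA Px Ax.
have -> : 'L_4(P) = [~: 'L_3(P), P] by [].
rewrite -quotient_cents2; last 2 first.
- exact: subset_trans (lcn_sub _ _) (normal_norm n5).
- exact: normal_norm n5.
rewrite centsC; apply: subset_trans (quotientS _ sPA) _.
rewrite quotientMl ?(subset_trans sA) ?normal_norm // mul_subG //.
  by rewrite centsC quotient_cents2r // comm_L3_A.
rewrite quotient_cycle ?(subsetP (normal_norm n5)) // cycle_subG.
apply/centP=> _ /morphimP[w _ Lw ->].
have /mulsgP[t y Tt /cycleP[i ->] ->] := subsetP sL3 w Lw.
have Pt := L_in (subsetP zpL4_sub t Tt).
rewrite /= cosetM ?groupX //; apply: commuteM.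
  by apply/commute_sym/(commute_mod n5) => //; apply: zpL4_comm.
by rewrite -expgM cosetX //; apply: commuteX.
Qed.

End ZpIndex.

Lemma zpL4_neq_L3 : 'L_4(P) != 1 -> ~~ ('L_3(P) \subset zpL4).
Proof.
move=> ntL4; apply: contra (L_strict ntL4) => sLT.
have -> : 'L_4(P) = [~: 'L_3(P), P] by [].
rewrite gen_subG.
by apply/subsetP=> _ /imset2P[t x Lt Px ->]; apply: zpL4_comm; rewrite ?(subsetP sLT).
Qed.

(** Suppose not. If |L_3 : L_4| = p, then T = L_4, so z and an inverted x outside A have p-th powers
    in L_4, and <x, z>L_3 / L_4 violates [card_inverted_lt]. If the index is p^2, any x outside A
    has x^p in T, hence lies in [rad], which is inside A. *)
Lemma L4_trivial : 'L_4(P) = 1.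
Proof.
apply/eqP/idPn => ntL4; have n4 := normal_L 4.
have neT := zpL4_neq_L3 ntL4.
have [k kE] := index_p_power 'L_4(P) (lcn_sub 3 P).
have k_gt0 : 0 < k.
  have := dvd_index_L ntL3; rewrite kE; case: (k) => //.
  by rewrite dvdn1 eqn_leq leqNgt prime_gt1.
have k_le : k <= 2 by rewrite -(@leq_exp2l p) ?prime_gt1 // -kE index_L3_L4.
have [k1 | k2] : k = 1%N \/ k = 2 by case: k k_gt0 k_le {kE} => [|[|[|]]]; auto.
  have := Lagrange_index zpL4_sub L4_sub_zpL4; rewrite kE k1 expn1 => oT.
  have iT : #|'L_3(P) : zpL4| = p.
    have /primeP[_ /(_ #|'L_3(P) : zpL4|)] := p_pr.
    rewrite -{1}oT dvdn_mulr // => /(_ isT)/orP[|/eqP//].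
    by rewrite indexg_eq1 (negPf neT).
  have L4zp : z ^+ p \in 'L_4(P).
    have /eqP := oT; rewrite iT -[X in _ == X]muln1 eqn_pmul2l ?prime_gt0 //.
    by rewrite indexg_eq1 join_subG cycle_subG => /andP[].
  have [x0 Px0 Ax0] := notin_A iT.
  have sL2A := subset_trans L2_sub_rad rad_sub_A.
  have [x [Px Ax ax _]] := exists_inverted sL2A Px0 Ax0.
  have L4xp : x ^+ p \in 'L_4(P).
    have := expp_notin_A iT ntL4 Px Ax; apply: subsetP.
    by rewrite join_subG subxx cycle_subG.
  pose S1 := z |: 'L_3(P); pose S := x |: S1.
  have sS1S : <<S1>> \subset <<S>> by apply: genS; apply: subsetUr.
  have sL3S1 : 'L_3(P) \subset <<S1>> by apply: sub_gen; apply: subsetUr.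
  have sSP : S \subset P by rewrite !subUset !sub1set Px Pz lcn_sub.
  have sHP : <<S>> \subset P by rewrite gen_subG.
  have sL4S1 := subset_trans (lcn_subS 3 P) sL3S1.
  have sL4S := subset_trans sL4S1 sS1S.
  suff: p ^ 3 <= #|<<S>> : 'L_4(P)|.
    rewrite leqNgt card_inverted_lt //.
    - exact: a_L.
    - have cL w y : w \in 'L_3(P) -> y \in P -> [~ w, y] \in 'L_4(P) by apply: comm_L.
      have cz y : y \in P -> [~ z, y] \in 'L_4(P) by apply: inverted_comm_L4.
      have sym u v : [~ u, v] \in 'L_4(P) -> [~ v, u] \in 'L_4(P).
        by rewrite -invg_comm groupV.
      move=> x1 x2 Sx1 Sx2; have [Px1 Px2] := (subsetP sSP _ Sx1, subsetP sSP _ Sx2).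
      case/setU1P: Sx1 => [->|/setU1P[->|Lx1]]; [|exact: cz|exact: cL].
      case/setU1P: Sx2 => [->|/setU1P[->|Lx2]].
      + by rewrite commgg group1.
      + by apply/sym/cz.
      + by apply/sym/cL.
    - by move=> x1 /setU1P[->|/setU1P[->|Lx1]] //; apply: L_expp.
    - move=> x1 /setU1P[->|/setU1P[->|Lx1]]; first by rewrite ax cosetV.
        by rewrite az cosetV.
      exact: a_L3_inv n4 (subxx _) Lx1.
    - by rewrite index_P_mid ?lcn_subS // kE k1 -expnD ltn_exp2l ?prime_gt1.
  have ltS1 : 'L_3(P) \proper <<S1>>.
    rewrite properE sL3S1; apply: contra L2z => /subsetP sSL.
    by apply/L_S/sSL; rewrite mem_gen // setU11.
  have ltS : <<S1>> \proper <<S>>.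
    rewrite properE sS1S; apply: contra Ax => /subsetP sSS.
    have: x \in <<S1>> by apply: sSS; rewrite mem_gen // setU11.
    apply: subsetP; rewrite gen_subG subUset sub1set (subsetP rad_sub_A) //=.
    exact: subset_trans (lcn_subS 2 P) sL2A.
  have := pgroup_index_ge (subset_trans sS1S sHP) ltS1.
  rewrite -(leq_pmul2l (prime_gt0 p_pr)) => /leq_trans/(_ (pgroup_index_ge sHP ltS)).
  rewrite -(Lagrange (lcn_subS 3 P)) -(Lagrange sL4S) kE k1.
  by rewrite mulnA mulnCA leq_pmul2l // mulnn -expnSr.
have i2 : #|'L_3(P) : 'L_4(P)| = (p ^ 2)%N by rewrite kE k2.
have iT := index_L3_zpL4_big i2.
have [x Px Ax] := notin_A iT; case/negP: (Ax); apply: (subsetP rad_sub_A).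
exact: expp_zpL4_rad (expp_notin_A iT ntL4 Px Ax).
Qed.

(** Let p > 3, x outside A and y in A outside [rad]. Then y^p generates L_3 modulo T, so x^p = y^(p
    i) modulo T for some i. The collection formula puts (x y^-i)^p in T, so x y^-i is in [rad],
    inside A, and x would be in A. *)
Lemma index_L3_L4_big_p3 : #|'L_3(P) : 'L_4(P)| = (p ^ 2)%N -> p = 3.
Proof.
move=> i2; have iT := index_L3_zpL4_big i2.
have nT := zpL4_normal; have sA := L2cent_sub nT.
have [p_le3 | p_gt3] := leqP p 3; first by apply/eqP; rewrite eqn_leq p_le3.
have nTL3 : zpL4 <| 'L_3(P) by apply: normalS zpL4_sub (lcn_sub _ _) nT.
have prT : prime #|'L_3(P) : zpL4| by rewrite iT.
have [x Px Ax] := notin_A iT.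
have [y Ay Ry] : exists2 y, y \in L2cent zpL4 & y \notin rad.
  apply/subsetPn; rewrite -indexg_eq1.
  by rewrite (index_L2cent_rad ntL3 nT L4_sub_zpL4) ?zpL4_sub // neq_ltn prime_gt1 ?orbT.
have Py := subsetP sA y Ay.
have Typ : y ^+ p \notin zpL4 by apply: contra Ry; apply: expp_zpL4_rad.
have sL3 := prime_index_sub_mul nTL3 prT (expp_L3 Py) Typ.
have /mulsgP[t s Tt /cycleP[i ->] xp] := subsetP sL3 _ (expp_L3 Px).
case/negP: Ax; pose yi := (y ^+ i)^-1.
have Ayi : yi \in L2cent zpL4 by rewrite groupV groupX.
rewrite -(groupMr x Ayi); apply: (subsetP (rad_sub_A)).
have Pyi := subsetP sA _ Ayi.
apply: expp_zpL4_rad => //; first exact: groupM.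
have Pt := L_in (subsetP zpL4_sub t Tt).
pose c := [~ yi, x]; pose d := [~ c, x].
have Lc : c \in 'L_2(P) by apply: comm_L; rewrite ?lcn1.
have Ld : d \in 'L_3(P) by apply: comm_L.
have [Pc Pd] := (L_in Lc, L_in Ld).
have cd w : w \in P -> commute (coset zpL4 d) (coset zpL4 w).
  exact: central_L nT L4_sub_zpL4 Ld.
rewrite -(coset1_mem nT) ?groupX ?groupM // (cosetX p nT (groupM Px Pyi)) cosetM //.
rewrite expMg_metabelian -?cosetR //; last 4 first.
- apply/commute_sym/(commute_mod nT) => //.
  by have /(L2centP nT Pyi) := Ayi; apply.
- exact: cd.
- exact: cd.
- exact: cd.
have c1 : coset zpL4 c ^+ p = 1.
  by rewrite -cosetX //; apply/coset_id/(subsetP L4_sub_zpL4)/L2_expp.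
have d1 : coset zpL4 d ^+ p = 1 by apply: coset_expp nT L4_sub_zpL4 Ld.
have /dvdnP[m2 ->] : p %| 'C(p, 2) by rewrite prime_dvd_bin.
(* This divisibility is where p > 3 enters. *)
have /dvdnP[m3 ->] : p %| 'C(p, 3) by rewrite prime_dvd_bin.
rewrite ![(_ * p)%N]mulnC !expgM c1 d1 !expg1n !mulg1 -!cosetX // xp.
rewrite cosetM ?groupX // (coset_id Tt) mul1g -cosetM ?groupX //.
by rewrite expgVn -!expgM mulnC mulgV coset_id.
Qed.

End Inverted.

Lemma class3_structure : 'L_3(P) != 1 ->
  'L_4(P) = 1 /\ (#|'L_3(P) : 'L_4(P)| = (p ^ 2)%N -> p = 3).
Proof.
move=> ntL3; have [z0 Rz0 L2z0] := rad_not_L2 ntL3.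
have Pz0 := subsetP rad_sub z0 Rz0.
have [z [Pz L2z az [u Lu def_z]]] := exists_inverted (subxx _) Pz0 L2z0.
have Rz : z \in rad by rewrite def_z groupM ?groupX ?(subsetP L2_sub_rad u Lu).
split; first exact (L4_trivial ntL3 Rz L2z az).
exact (index_L3_L4_big_p3 ntL3 Rz L2z az).
Qed.

End Involution.

Lemma class_order_bound : prime q -> 2 < p ->
  nil_class P <= 3 /\ #|P| <= p ^ 6 /\ (#|P| = (p ^ 6)%N -> p = 3 /\ q = 2).
Proof.
move=> q_pr p_gt2; have p_gt1 := prime_gt1 p_pr; have nilP := pgroup_nil pP.
have small : 'L_3(P) = 1 ->
    nil_class P <= 3 /\ #|P| <= p ^ 6 /\ (#|P| = (p ^ 6)%N -> p = 3 /\ q = 2).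
  move=> L3; have oP : #|P| <= p ^ 4.
    have := index_P_L 1; rewrite L3 indexg1 => ->.
    by rewrite (expnSr p 3) leq_pmul2l ?expn_gt0 ?prime_gt0 // -L3 index_L2_L3_le.
  split; first by apply/(lcn_nil_classP _ nilP)/(L_trivial_le _ L3).
  split; first by rewrite (leq_trans oP) ?leq_exp2l.
  by move=> oP6; move: oP; rewrite oP6 leq_exp2l.
have [/eqP l2 | /eqP l2] := boolP (l * l == 1 %[mod p])%N; last by apply/small/L3_trivial.
(* For odd q, l^2 = 1 turns l^q = 1 into l = 1. *)
have q2 : q = 2.
  case: (even_prime q_pr) => // q_odd; case: l1; rewrite -lq.
  rewrite -(odd_double_half q) q_odd expnD expn1 -mul2n expnM -mulnn.
  by rewrite -modnMmr -modnXm l2 modnXm exp1n modnMmr muln1.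
have a2 x : a (a x) = x by have := a_iter x; rewrite q2.
have [L3 | ntL3] := eqVneq ('L_3(P) : {set gT}) 1; first exact: small.
have [L4 p3] := class3_structure a2 l2 p_gt2 ntL3.
have oP : #|P| = (p ^ 4 * #|'L_3(P) : 'L_4(P)|)%N.
  have <- : #|P : 'L_4(P)| = (p ^ 4 * #|'L_3(P) : 'L_4(P)|)%N.
    exact: index_P_mid ntL3 (lcn_subS 3 P).
  by rewrite L4 indexg1.
split; first exact/(lcn_nil_classP _ nilP).
split.
  by rewrite oP (expnD p 4 2) leq_pmul2l ?expn_gt0 ?prime_gt0 ?index_L3_L4.
move=> /eqP; rewrite oP (expnD p 4 2) eqn_pmul2l ?expn_gt0 ?prime_gt0 //.
by move/eqP/p3.
Qed.

End Core.

(** * From maximal pairs to the hypotheses of the core argument *)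

Section Reduction.

Import GroupScope.

Variable p : nat.
Hypothesis p_pr : prime p.

(** Fix u <> 1 with b u = u^l. For v outside <u>, with b v = v^i and b (u v) = (u v)^k, one gets u^l
    v^i = u^k v^k. As <u> and <v> meet trivially, l = k modulo p and v^i = v^k. *)
Lemma power_aut_abelem (gT : finGroupType) (V : {group gT}) (b : {perm gT}) :
  p.-abelem V -> power_aut V b -> exists l, {in V, forall v, b v = v ^+ l}.
Proof.
move=> abV [Autb pow_b]; have /abelemP[//|cVV expV] := abV.
have bM : {in V &, {morph b : x y / x * y}}.
  by move=> x y Vx Vy; rewrite -!(autmE Autb) morphM.
have bX v : v \in V -> exists i, b v = v ^+ i.
  move=> Vv; have : b v \in <[v]>.
    have <- : b @: <[v]> = <[v]> by apply: pow_b; rewrite cycle_subG.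
    exact/imset_f/cycle_id.
  by case/cycleP=> i ->; exists i.
have [V1 | /trivgPn[u Vu ntu]] := eqsVneq V 1.
  exists 0 => v; rewrite V1 => /set1P->; rewrite expg0.
  by rewrite -(autmE Autb) morph1.
have [l bu] := bX u Vu; exists l => v Vv.
have [/cycleP[i ->] | uv] := boolP (v \in <[u]>).
  by rewrite -(autmE Autb) morphX //= autmE bu expgAC.
have [i bv] := bX v Vv; have [k buv] := bX _ (groupM Vu Vv).
have TIuv w : w \in <[u]> -> w \in <[v]> -> w = 1.
  have ntv : v != 1 by apply: contraNneq uv => ->.
  have prv : prime #|<[v]>| by rewrite -orderE (abelem_order_p abV).
  move=> uw vw; apply/set1P; rewrite -[[set 1]](prime_TIg prv (_ : ~~ (_ \subset <[u]>))).
    by rewrite inE vw.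
  by rewrite cycle_subG.
have cuv : commute u v by apply: (centsP cVV).
have E : u ^+ l * v ^+ i = u ^+ k * v ^+ k by rewrite -bu -bv -bM // buv expgMn.
have E' : (u ^+ k)^-1 * u ^+ l = v ^+ k * (v ^+ i)^-1.
  by apply: (mulgI (u ^+ k)); apply: (mulIg (v ^+ i)); rewrite mulKVg mulgA mulgKV.
have e1 : (u ^+ k)^-1 * u ^+ l = 1.
  apply: TIuv; first by rewrite groupM ?groupV ?mem_cycle.
  by rewrite E' groupM ?groupV ?mem_cycle.
have ulk : u ^+ l = u ^+ k by apply/eqP; rewrite eq_sym eq_mulVg1 e1.
have vik : v ^+ i = v ^+ k by apply/eqP; rewrite eq_sym eq_mulgV1 -E' e1.
have up := expV u Vu; have vp := expV v Vv.
have /eqP lk : l = k %[mod p].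
  apply/eqP/negPn/negP => /eqP nlk.
  by move: ntu; rewrite (expg_ncongr_eq1 p_pr nlk up ulk) eqxx.
by rewrite bv vik; apply/esym/(expg_congr (eqP lk)).
Qed.

(** Burnside basis theorem: representatives of generators of P / Phi(P) generate P. *)
Lemma grank_quotient_Phi (gT : finGroupType) (P : {group gT}) :
  'm(P) <= 'm(P / 'Phi(P)).
Proof.
have [B genB <-] := grank_witness (P / 'Phi(P)).
have nPhi := gFnorm _ P : P \subset 'N('Phi(P)).
pose C := [set repr (v : {set gT}) | v : coset_of 'Phi(P) in B].
have sBV : B \subset P / 'Phi(P) by rewrite -genB subset_gen.
have cC v : v \in B -> coset 'Phi(P) (repr v) = v by rewrite coset_reprK.
have sCP : C \subset P.
  apply/subsetP=> _ /imsetP[v Bv ->].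
  suff: repr v \in coset 'Phi(P) @*^-1 (P / 'Phi(P)).
    by rewrite quotientGK ?Phi_normal.
  apply: mem_morphpre; first exact: repr_coset_norm.
  by rewrite /= coset_reprK (subsetP sBV).
have genC : <<C>> = P.
  apply: (@Phi_nongen _ P C); apply/eqP; rewrite eqEsubset join_subG Phi_sub sCP /=.
  rewrite -(quotientSGK _ (joing_subl _ _)) // -genB gen_subG.
  apply/subsetP=> v Bv; rewrite -(cC v Bv); apply: mem_quotient.
  by apply: (subsetP (joing_subr _ _)); apply: imset_f.
rewrite -{1}genC; apply: leq_trans (grank_min C) _.
exact: leq_imset_card.
Qed.

Lemma card_abelem_grank (gT : finGroupType) (E : {group gT}) :
  p.-abelem E -> #|E| = (p ^ 'm(E))%N.
Proof.
move=> abE; rewrite (grank_abelian (abelem_abelian abE)) (rank_abelem abE).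
exact: card_pgroup (abelem_pgroup abE).
Qed.

Section MaximalPair.

Variables (q : nat) (gT : finGroupType) (P : {group gT}) (a : {perm gT}).
Hypothesis mPa : maximal_pair p q 3 P a.

Let pP := maxpair_pgroup mPa.
Let AutPa := maxpair_aut mPa.

Lemma maximal_pair_abelem_card (N : {group gT}) (E : {group coset_of N}) :
  N <| P -> E \subset P / N -> p.-abelem E -> #|E| <= p ^ 3.
Proof.
move=> nN sEP abE; rewrite (card_abelem_grank abE) leq_exp2l ?prime_gt1 //.
pose H := (coset N @*^-1 E)%G; have sHP : H \subset P by rewrite sub_cosetpre_quo.
apply: leq_trans (maxpair_sub_rank mPa sHP).
have <- : H / N = E by apply: cosetpreK.
by apply: quotient_grank; rewrite (subset_trans sHP) ?normal_norm.
Qed.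

(** The preimage H of E needs 3 generators, and Phi(H) lies in N with |H : Phi(H)| = p^3 = |H : N|,
    so N = Phi(H). Thus a stabilizes H and induces a nontrivial power on H / Phi(H), against
    [maxpair_maximal]. *)
Lemma maximal_pair_no_section (N : {group gT}) (E : {group coset_of N}) (m : nat) :
    N <| P -> {in N, forall x, a x \in N} -> E \proper P / N -> p.-abelem E ->
    #|E| = (p ^ 3)%N -> m <> 1 %[mod p] ->
    {in P, forall x, coset N x \in E -> coset N (a x) = coset N x ^+ m} ->
  False.
Proof.
move=> nN aN prE abE oE m1 aE; have nNP := normal_norm nN.
pose H := (coset N @*^-1 E)%G.
have prH : H \proper P by rewrite /= -(quotientGK nN) cosetpre_proper.
have sHP := proper_sub prH; have pH := pgroupS sHP pP.
have HE : H / N = E by apply: cosetpreK.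
have sNH : N \subset H by apply: sub_cosetpre.
have mH : 'm(H) = 3.
  apply/eqP; rewrite eqn_leq (maxpair_sub_rank mPa sHP) /=.
  have -> : 3 = 'm(E).
    by apply/eqP; rewrite -(eqn_exp2l _ _ (prime_gt1 p_pr)) -oE card_abelem_grank.
  by rewrite -{1}HE quotient_grank // (subset_trans sHP).
have sPhiN : 'Phi(H) \subset N.
  by apply: Phi_min pH _ _; rewrite ?HE // (subset_trans sHP).
have abH := Phi_quotient_abelem pH.
have iPhi : #|H : 'Phi(H)| = (p ^ 3)%N.
  apply/eqP; rewrite eqn_leq; apply/andP; split.
    rewrite -card_quotient ?gFnorm // (card_abelem_grank abH).
    by rewrite leq_exp2l ?prime_gt1 // -mH quotient_grank ?gFnorm.
  have <- : #|H : N| = (p ^ 3)%N by rewrite -card_quotient ?(subset_trans sHP) // HE.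
  by apply: dvdn_leq; rewrite ?indexg_gt0 ?indexgS.
have sNPhi : N \subset 'Phi(H).
  have := Lagrange_index sNH sPhiN.
  rewrite iPhi -card_quotient ?(subset_trans sHP) // HE oE => /eqP.
  by rewrite -[X in _ == X]muln1 eqn_pmul2l ?expn_gt0 ?prime_gt0 // indexg_eq1.
have aP x : x \in P -> a x \in P by move=> Px; rewrite Aut_closed.
have inE' x : x \in P -> (x \in H) = (coset N x \in E) by apply: in_cosetpre.
have ax x : x \in H -> exists2 n, n \in N & a x = x ^+ m * n.
  move=> Hx; have Px := subsetP sHP x Hx.
  apply: (coset_eqP nN); rewrite ?aP ?groupX //.
  by rewrite (cosetX m nN Px) aE // -inE'.
have aH : a @: H = H :> {set gT}.
  apply/eqP; rewrite eqEcard card_imset ?leqnn ?andbT; last exact: perm_inj.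
  apply/subsetP=> _ /imsetP[x Hx ->]; have [n Nn ->] := ax x Hx.
  by rewrite groupM ?groupX ?(subsetP sNH n Nn).
have mHP : 'm(H) = 'm(P) by rewrite mH (maxpair_rank mPa).
have [//|] := maxpair_maximal mPa prH mHP; apply.
have nPhi := Phi_normal H.
have bE v : v \in H / 'Phi(H) -> frattini_aut H a v = v ^+ m.
  case/morphimP=> x _ Hx -> /=; rewrite (frattini_autE AutPa sHP aH Hx).
  have [n Nn ->] := ax x Hx.
  rewrite (cosetM nPhi) ?groupX ?(subsetP sNH n Nn) //.
  by rewrite (coset_id (subsetP sNPhi n Nn)) mulg1 (cosetX m nPhi Hx).
split; first split; first exact: frattini_aut_Aut AutPa sHP.
  move=> K sKH; apply/eqP; rewrite eqEcard card_imset ?leqnn ?andbT; last exact: perm_inj.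
  by apply/subsetP=> _ /imsetP[v Kv ->]; rewrite bE ?(subsetP sKH) ?groupX.
apply/eqP=> b1.
have /trivgPn[v Hv /eqP[]] : H / 'Phi(H) != 1.
  rewrite trivg_card1 card_quotient ?gFnorm // iPhi.
    by rewrite -[1%N](exp1n 3) eqn_exp2r // neq_ltn prime_gt1 ?orbT.
have /abelemP[//|_ expH] := abH.
apply: (expg_ncongr_eq1 p_pr m1 (expH v Hv)).
by rewrite -bE // b1 perm1 expg1.
Qed.

Hypothesis q_pr : prime q.

Lemma maximal_pair_bound :
  nil_class P <= 3 /\ #|P| <= p ^ 6 /\ (#|P| = (p ^ 6)%N -> p = 3 /\ q = 2).
Proof.
have q_lt : q < p.
  rewrite -(ltn_predK (prime_gt1 p_pr)) ltnS -subn1.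
  by rewrite dvdn_leq ?subn_gt0 ?prime_gt1 // (maxpair_dvd mPa).
have p_gt2 : 2 < p := leq_ltn_trans (prime_gt1 q_pr) q_lt.
have pNq : ~~ (p %| q) by rewrite gtnNdvd ?prime_gt0.
have abV := Phi_quotient_abelem pP.
have iPhi : #|P : 'Phi(P)| = (p ^ 3)%N.
  rewrite -card_quotient ?gFnorm // (card_abelem_grank abV); congr (_ ^ _)%N.
  rewrite -(maxpair_rank mPa); apply/eqP.
  by rewrite eqn_leq grank_quotient_Phi quotient_grank ?gFnorm.
have [pow_b /eqP nt_b] := maxpair_power mPa.
have [l bl] := power_aut_abelem abV pow_b.
have aP : a @: P = P :> {set gT}.
  apply/eqP; rewrite eqEcard card_imset ?leqnn ?andbT; last exact: perm_inj.
  by apply/subsetP=> _ /imsetP[x Px ->]; rewrite Aut_closed.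
have aPhi : {in P, forall x, coset 'Phi(P) (a x) = coset 'Phi(P) x ^+ l}.
  move=> x Px; rewrite -(frattini_autE AutPa (subxx P) aP Px) bl //.
  exact: mem_quotient.
have a_iter x : iter q a x = x.
  by rewrite -permX -(maxpair_order mPa) expg_order perm1.
have /abelemP[//|_ expV] := abV.
have l1 : l <> 1 %[mod p].
  move=> l1; apply: nt_b; apply/permP=> v; rewrite perm1.
  have [Vv|nVv] := boolP (v \in P / 'Phi(P)).
    by rewrite bl // (expg_congr l1) ?expg1 // expV.
  by rewrite (out_Aut pow_b.1).
(* Since a^q = 1, the power l^q is trivial on P / Phi(P), a nontrivial group of exponent p. *)
have lq : l ^ q = 1 %[mod p].
  apply/eqP/negPn/negP=> /eqP nlq.
  have /trivgPn[_ /morphimP[x _ Px ->] /eqP[]] : P / 'Phi(P) != 1.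
    rewrite trivg_card1 card_quotient ?gFnorm // iPhi.
    by rewrite -[1%N](exp1n 3) eqn_exp2r // neq_ltn prime_gt1 ?orbT.
  apply: (expg_ncongr_eq1 p_pr nlq); first by apply: expV; apply: mem_quotient.
  have itE i : iter i a x \in P /\
      coset 'Phi(P) (iter i a x) = coset 'Phi(P) x ^+ (l ^ i).
    elim: i => [|i [Pi IHi]] /=; first by rewrite expg1.
    by rewrite Aut_closed // aPhi // IHi -expgM -expnSr.
  by rewrite -(itE q).2 a_iter expg1.
exact: (class_order_bound p_pr pP AutPa aPhi a_iter lq pNq l1 iPhi
  maximal_pair_abelem_card maximal_pair_no_section q_pr p_gt2).
Qed.

End MaximalPair.

End Reduction.

Theorem mainTheorem8 (p q : nat) (p_prime : prime p) (q_prime : prime q)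
    (gT : finGroupType) (P : {group gT}) (a : {perm gT})
    (maxPa : maximal_pair p q 3 P a) :
  nil_class P <= 3 /\ #|P| <= p ^ 6 /\ (#|P| = p ^ 6 -> p = 3 /\ q = 2).
Proof. exact (maximal_pair_bound p_prime maxPa q_prime). Qed.
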